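(* Let $W$ be a finite Weyl group acting on $V$, with weight lattice $P\subset V$, and let $\pi,\eta:[0,T]\to V$ be integral dominant paths. Then the map $I$ restricts to a map $I:LR(\pi,\eta)\to LR(I(\eta),I(\pi))$ which is a bijective involution (bijective, with $I\circ I$ the identity on $LR(\pi,\eta)$) and preserves the end points.
   Context: $V$ is a finite-dimensional real vector space carrying a root system with simple roots $\alpha_i\in V$, simple coroots $\alpha_i^\vee\in V^\vee$, simple reflections $s_i(v)=v-\alpha_i^\vee(v)\alpha_i$ generating $W$, longest element $w_0$, and weight lattice $P=\{\lambda\in V:\alpha_i^\vee(\lambda)\in\mathbb Z\ \forall i\}$ ($V$ is spanned by the roots). Paths are continuous maps $\pi:[0,T]\to V$ with $\pi(0)=0$. A path is dominant if $\alpha_i^\vee(\pi(t))\ge0$ for all $i,t$; integral if $\pi(T)\in P$ and $\min_t\alpha_i^\vee(\pi(t))\in\mathbb Z$ for all $i$. For a simple root $\alpha$, $\mathcal P_\alpha\pi(t)=\pi(t)-\inf_{0\le s\le t}\alpha^\vee(\pi(s))\alpha$; for a reduced decomposition $w=s_{i_1}\cdots s_{i_k}$, $\mathcal P_w=\mathcal P_{\alpha_{i_1}}\cdots\mathcal P_{\alpha_{i_k}}$, which depends only on $w$. Let $\kappa\pi(t)=\pi(T-t)-\pi(T)$ and $I=\mathcal P_{w_0}(-w_0)\kappa$, where $-w_0$ acts pointwise on paths. Littelmann operators: for a simple root $\alpha$ and $x\in\mathbb R$, if $-2\alpha^\vee(\pi(T))+2\inf_t\alpha^\vee(\pi(t))\le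 x\le-2\inf_t\alpha^\vee(\pi(t))$, then $E_\alpha^x\pi$ is the unique path with $\mathcal P_\alpha E_\alpha^x\pi=\mathcal P_\alpha\pi$ and $\alpha^\vee(E_\alpha^x\pi(T))=\alpha^\vee(\pi(T))+x$; otherwise $E_\alpha^x\pi=\mathbf 0$. Put $e_\alpha=E_\alpha^2$, $f_\alpha=E_\alpha^{-2}$. For a dominant integral path $\eta$, the Littelmann module $B\eta$ is the set of all paths ($\ne\mathbf 0$) obtained from $\eta$ by finite products of the $e_\alpha,f_\alpha$, $\alpha$ simple. Concatenation of $\pi,\mu:[0,T]\to V$: $\pi\star\mu(t)=\pi(2t)$ for $0\le t\le T/2$ and $\pi\star\mu(t)=\pi(T)+\mu(2(t-T/2))$ for $T/2\le t\le T$. Define $LR(\pi,\eta)=\{\pi\star\mu\;|\;\mu\in B\eta,\ \pi\star\mu\text{ is dominant}\}$. ''Preserves the end points'' means $I(\gamma)(T)=\gamma(T)$ for $\gamma\in LR(\pi,\eta)$. *)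

(* Defs.v *)
From mathcomp Require Import all_boot all_order all_algebra.
From mathcomp Require Import all_classical all_reals topology normedtype.

Set Implicit Arguments.
Unset Strict Implicit.
Unset Printing Implicit Defensive.

Import Order.TTheory GRing.Theory Num.Theory.
Import numFieldNormedType.Exports.

Local Open Scope classical_set_scope.
Local Open Scope ring_scope.

(* A crystallographic root system spanning V, with a choice of simple roots.
   [coroot a] is only meaningful for [a \in roots]. *)
Record rootSystem (R : realType) (V : vectType R) := RootSystem {
  roots : seq V;
  coroot : V -> {scalar V};
  rank : nat;
  simple : 'I_rank -> V;
  roots_neq0 : 0 \notin roots;
  roots_span : <<roots>>%VS = fullv;
  coroot_self : {in roots, forall a, coroot a a = 2};
  coroot_int : {in roots &, forall a b, coroot a b \is a Num.int};
  roots_refl : {in roots &, forall a b, b - coroot a b *: a \in roots};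
  simple_root : forall i, simple i \in roots;
  simple_basis : basis_of fullv [seq simple i | i : 'I_rank];
  simple_coef : {in roots, forall b, exists c : 'I_rank -> nat,
    b = \sum_i (c i)%:R *: simple i \/ b = - \sum_i (c i)%:R *: simple i}
}.

Section Weyl.
Variables (R : realType) (V : vectType R) (Phi : rootSystem V).
Implicit Types (i : 'I_(rank Phi)) (ws : seq 'I_(rank Phi)) (w : V -> V).

Definition simple_coroot i : {scalar V} := coroot Phi (simple i).

Definition simple_refl i (v : V) : V := v - simple_coroot i v *: simple i.

(* the product s_{i_1} ... s_{i_k} in W, as a transformation of V *)
Definition weyl_word ws : V -> V :=
  foldr (fun i w => simple_refl i \o w) idfun ws.

Definition weyl_group : set (V -> V) := range weyl_word.

Definition reduced_decomposition w ws :=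
  w = weyl_word ws /\
  forall ws', w = weyl_word ws' -> (size ws <= size ws')%N.

Definition longest_element w0 :=
  weyl_group w0 /\
  forall ws0 w ws, reduced_decomposition w0 ws0 ->
    weyl_group w -> reduced_decomposition w ws -> (size ws <= size ws0)%N.

Definition weight_lattice : set V :=
  [set v | forall i, simple_coroot i v \is a Num.int].

End Weyl.

(* A path [0, T] -> V is encoded as a function R -> V that vanishes outside
   [0, T]; two paths are then equal iff they agree on [0, T]. *)
Section Paths.
Variables (R : realType) (V : vectType R) (T : R).
Implicit Types (p q m eta : R -> V).

Definition on0T p : R -> V := fun t => if 0 <= t <= T then p t else 0.

(* V carries no norm in MathComp: its canonical topology is that of R^n, read
   through the coordinates in a basis. *)
Definition is_path p :=
  [/\ {within `[0, T], continuous (passmx.rVof (vbasis {:V}) \o p)},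
      p 0 = 0 & on0T p = p].

Definition kappa p := on0T (fun t => p (T - t) - p T).

Definition concat p q := on0T (fun t =>
  if t <= T / 2 then p (2 * t) else p T + q (2 * (t - T / 2))).

Section Operators.
Variable Phi : rootSystem V.
Implicit Types (i : 'I_(rank Phi)) (ws : seq 'I_(rank Phi)) (w : V -> V).

(* For a path, these infima are minima of continuous functions. *)
Definition inf_coroot i p (t : R) : R :=
  inf [set simple_coroot i (p s) | s in `[0, t]].

Definition dominant p :=
  forall i t, 0 <= t <= T -> 0 <= simple_coroot i (p t).

Definition integral p :=
  weight_lattice Phi (p T) /\ forall i, inf_coroot i p T \is a Num.int.

Definition pitman i p :=
  on0T (fun t => p t - inf_coroot i p t *: simple i).

(* P_{i_1} ... P_{i_k}; this is P_w when [ws] is reduced for [w] *)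
Definition pitman_word ws p : R -> V := foldr pitman p ws.

(* P_{w0} (- w0) kappa, with [ws] a reduced decomposition of [w0] *)
Definition schutzenberger w0 ws p : R -> V :=
  pitman_word ws (fun t => - w0 (kappa p t)).

(* [None] is the extra symbol 0 for "undefined"; [xget] picks the unique
   element of the set. *)
Definition littelmann (x : R) i p : option (R -> V) :=
  if - 2 * simple_coroot i (p T) + 2 * inf_coroot i p T <= x
       <= - 2 * inf_coroot i p T
  then Some (xget (fun=> 0) [set q | [/\ is_path q, pitman i q = pitman i p &
         simple_coroot i (q T) = simple_coroot i (p T) + x]])
  else None.

Definition littelmann_e := littelmann 2.
Definition littelmann_f := littelmann (- 2).

Inductive littelmann_module eta : set (R -> V) :=
| littelmann_gen : littelmann_module eta eta
| littelmann_mod_e i p q : littelmann_module eta p ->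
    littelmann_e i p = Some q -> littelmann_module eta q
| littelmann_mod_f i p q : littelmann_module eta p ->
    littelmann_f i p = Some q -> littelmann_module eta q.

Definition LR p eta : set (R -> V) :=
  [set concat p m | m in littelmann_module eta] `&` [set g | dominant g].

End Operators.
End Paths.

(* Main.v *)
Require Import Defs.
From HB Require Import structures.
From mathcomp Require Import all_boot all_order all_algebra.
From mathcomp Require Import all_classical all_reals topology normedtype derive.
From mathcomp Require Import ring lra zify.

Set Implicit Arguments.
Unset Strict Implicit.
Unset Printing Implicit Defensive.

Import Order.TTheory GRing.Theory Num.Theory.
Import numFieldNormedType.Exports.

Local Open Scope classical_set_scope.
Local Open Scope ring_scope.

(* I is P_{w0} composed with the involution S = - w0 kappa, which exchanges the
   two factors of a concatenation.

   Braid relations.  An alternating product of n transforms P_a P_b P_a ...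
   subtracts from a path the infima over chains t >= s_0 >= s_1 >= ... of
   sum_k c_k Z_k(s_k), with Z_k alternately the two coroot functions and c_k the
   coefficients of the roots of the dihedral subsystem.  This follows by
   induction on the innermost transform from Pitman's identity
   inf_[p,r] (g - 2 J) + J(p) + J(r) = inf_[p,r] g, J the running infimum of g.
   When c_m = 0 the formula becomes symmetric in a and b.  With Matsumoto's theorem,
   P_{w0} can start and end with any P_a; hence P_{w0} p is dominant and
   depends only on the class of p under the relations P_a p = P_a q.

   Involution.  Pitman's identity also gives P_a kappa P_a = P_a kappa, so that
   P_{w0} S P_{w0} = P_{w0} S and I I = id on dominant paths.  The end points of
   a class are stable under W and lie below that of the dominant path;
   therefore I preserves end points, and S g is moved to I g by extremal
   (hence integral) steps.

   Concatenation.  P_a (p * q) = P_a p * q' with q' on the a-string of q.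
   Applied along w0 to S (pi * mu) = S mu * S pi, this gives I eta * rho; rho is in
   the module of I pi provided that the amounts moved are integers, that is,
   the string of S mu is integral.  Integrality of strings along a reduced
   word is invariant under braid moves: in type A2 by a tropical Pluecker
   relation, and in types B2 and G2 by folding A3 and D4. *)

(** * Running infima of continuous functions *)

Section RunningInfimum.
Context {R : realType}.
Implicit Types (g h : R -> R) (T : R).

(** Continuity relative to the interval, in epsilon-delta form, so that the estimates on infima
    reduce to linear arithmetic; [contP] links it to the subspace topology. *)
Definition cont T g := forall x, 0 <= x <= T -> forall e, 0 < e ->
  exists2 d, 0 < d & forall y, 0 <= y <= T -> `|y - x| < d -> `|g y - g x| < e.

Lemma contP T g : cont T g <-> {within `[0, T], continuous g}.
Proof.
rewrite subspace_continuousP; split=> gc x xT.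
  have {}xT : 0 <= x <= T by move: xT; rewrite /= in_itv.
  apply/cvgrPdist_lt => e e0; have [d d0 dP] := gc x xT e e0.
  rewrite near_withinE; near=> y => yT; rewrite distrC; apply: dP.
    by move: yT; rewrite /= in_itv.
  by rewrite distrC; near: y; apply: (@cvgr_dist_lt _ _ _ _ _ id).
move=> e e0.
have {}xT : `[0, T]%classic x by rewrite /= in_itv.
have /cvgrPdist_lt/(_ e e0) := gc x xT.
rewrite near_withinE => /nbhs_ballP[d d0 dP]; exists d => // y yT yx.
rewrite distrC; apply: dP; last by rewrite /= in_itv.
by rewrite /ball /= distrC.
Unshelve. all: by end_near. Qed.

Lemma cont_within T g p r : cont T g -> 0 <= p -> r <= T ->
  {within `[p, r], continuous g}.
Proof.
move=> /contP gc p0 rT; apply: continuous_subspaceW gc => x /=.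
by rewrite !in_itv /= => /andP[? ?]; lra.
Qed.

Lemma cont_argmin T g p r : cont T g -> 0 <= p -> p <= r -> r <= T ->
  exists2 s, p <= s <= r & forall u, p <= u <= r -> g s <= g u.
Proof.
move=> gc p0 pr rT.
have [s sP sM] := EVT_min pr (cont_within gc p0 rT).
exists s; first by move: sP; rewrite in_itv.
by move=> u uP; apply: sM; rewrite in_itv.
Qed.

Lemma cont_ivt T g p r v : cont T g -> 0 <= p -> p <= r -> r <= T ->
  g r <= v <= g p -> exists2 s, p <= s <= r & g s = v.
Proof.
move=> gc p0 pr rT /andP[v1 v2].
have [|s sP sE] := IVT (v := v) pr (cont_within gc p0 rT).
  by rewrite ge_min le_max v1 v2 orbT.
by exists s => //; move: sP; rewrite in_itv.
Qed.

Definition runinf g t := inf [set g s | s in `[0, t]].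

Lemma runinf_attained T g t : cont T g -> 0 <= t <= T ->
  exists2 s, 0 <= s <= t &
    runinf g t = g s /\ forall u, 0 <= u <= t -> g s <= g u.
Proof.
move=> gc /andP[t0 tT].
have [s sP sM] := cont_argmin gc (lexx 0) t0 tT.
exists s => //; split => //; apply/eqP; rewrite eq_le; apply/andP; split.
  apply: ge_inf; last by exists s => //=; rewrite in_itv.
  by exists (g s) => _ [u + <-]; rewrite /= in_itv; exact: sM.
apply: lb_le_inf; first by exists (g s), s => //=; rewrite in_itv.
by move=> _ [u + <-]; rewrite /= in_itv; exact: sM.
Qed.

Lemma runinf_le T g s t : cont T g -> 0 <= s <= t -> t <= T ->
  runinf g t <= g s.
Proof.
move=> gc st tT; have [|u _ [-> uM]] := @runinf_attained _ _ t gc.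
  by lra.
exact: uM.
Qed.

Lemma le_runinf T g t x : cont T g -> 0 <= t <= T ->
  (forall s, 0 <= s <= t -> x <= g s) -> x <= runinf g t.
Proof. by move=> gc tT xg; have [s ? [-> _]] := runinf_attained gc tT; exact: xg. Qed.

Lemma runinf_anti T g s t : cont T g -> 0 <= s <= t -> t <= T ->
  runinf g t <= runinf g s.
Proof.
move=> gc /andP[s0 st] tT; apply: (le_runinf gc) => [|u uP].
  by lra.
by apply: (runinf_le gc) => //; lra.
Qed.

Lemma runinf0 T g : cont T g -> 0 <= T -> runinf g 0 = g 0.
Proof.
move=> gc T0; have [|s + [-> _]] := @runinf_attained _ _ 0 gc.
  by rewrite lexx.
by rewrite -eq_le => /eqP <-.
Qed.

Lemma runinf_split T g s t : cont T g -> 0 <= s <= t -> t <= T ->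
  runinf g t = runinf g s \/
  exists2 u, s <= u <= t & runinf g t = g u /\ g u <= runinf g s.
Proof.
move=> gc st tT; have stA := runinf_anti gc st tT.
have [|u uP [E uM]] := @runinf_attained _ _ t gc; first by lra.
have [su|us] := leP s u.
  by right; exists u; [lra | split=> //; rewrite -E].
left; apply/eqP; rewrite eq_le stA E andTb -/(runinf _ _).
by apply: (runinf_le gc); [lra|lra].
Qed.

Lemma cont_runinf T g : cont T g -> cont T (runinf g).
Proof.
move=> gc x xT e e0.
have [|d d0 dP] := gc x xT (e / 2); first by lra.
have dP' y : 0 <= y <= T -> `|y - x| < d -> g x - e/2 < g y < g x + e/2.
  by move=> yT /(dP _ yT); rewrite ltr_norml => ?; lra.
have key s t : 0 <= s -> s <= t -> t <= T -> `|s - x| < d -> `|t - x| < d ->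
    runinf g s - e < runinf g t <= runinf g s.
  move=> s0 st tT sx tx.
  have sT : 0 <= s <= t by lra.
  rewrite (runinf_anti gc sT tT) andbT.
  have [->|[u uP [-> _]]] := runinf_split gc sT tT; first by lra.
  have : runinf g s <= g s by apply: (runinf_le gc); [lra|lra].
  have : `|u - x| < d by move: sx tx; rewrite !ltr_norml => *; lra.
  have uT : 0 <= u <= T by lra.
  move=> /(dP' _ uT).
  have /dP'/(_ sx) : 0 <= s <= T by lra.
  lra.
exists d => // y yT yx; rewrite ltr_norml.
have xx : `|x - x| < d by rewrite subrr normr0.
have [xy|yx'] := leP x y.
  have [x0 yT'] : 0 <= x /\ y <= T by split; lra.
  by have := key x y x0 xy yT' xx yx; lra.
have [y0 xT'] : 0 <= y /\ x <= T by split; lra.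
have {}yx' := ltW yx'.
by have := key y x y0 yx' xT' yx xx; lra.
Qed.

(** The time sought is the infimum of the times after [p] at which [g] is at most [v]. Continuity
    gives [g s <= v], and a smaller value before [s] would yield an earlier hit by the intermediate
    value theorem. *)
Lemma first_hit T g p t v : cont T g -> 0 <= p <= t -> t <= T ->
  runinf g t < v <= runinf g p ->
  exists2 s, p <= s <= t & g s = v /\ runinf g s = v.
Proof.
move=> gc pt tT /andP[Iv vI].
have [E|[x xP [E _]]] := runinf_split gc pt tT; first by lra.
pose A := [set s | p <= s <= x /\ g s <= v].
have Ax : A x by split; [lra | lra].
have Alb : has_lbound A by exists p => u [/andP[]].
have Ai : has_inf A by split => //; exists x.
set s := inf A.
have sx : s <= x by exact: ge_inf.
have ps : p <= s by apply: lb_le_inf => [|u [+ _]]; [exists x | lra].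
have gpv : v <= g p.
  by apply: le_trans vI _; apply: (runinf_le gc); [|]; lra.
have sT : 0 <= s <= T by lra.
have gsv : g s <= v.
  rewrite leNgt; apply/negP => vs.
  have [|d d0 dP] := gc s sT (g s - v); first by lra.
  have [u [uP gu] us] := inf_adherent d0 Ai.
  have su : s <= u by apply: ge_inf.
  have : `|g u - g s| < g s - v.
    apply: dP; first by lra.
    by rewrite ltr_norml; apply/andP; split; rewrite -/s in us; lra.
  by rewrite ltr_norml; lra.
have vgs u : p <= u <= s -> v <= g u.
  move=> /andP[pu us]; rewrite leNgt; apply/negP => guv.
  have [p0 uT gpu] : [/\ 0 <= p, u <= T & g u <= v <= g p] by split; lra.
  have [w wP gw] := cont_ivt gc p0 pu uT gpu.
  have sw : s <= w by apply: ge_inf => //; split; lra.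
  have wu : w = u by lra.
  by rewrite wu in gw; lra.
have gs : g s = v by apply/eqP; rewrite eq_le gsv vgs //; lra.
exists s; first by lra.
split=> //; apply/eqP; rewrite eq_le; apply/andP; split.
  by rewrite -gs; apply: (runinf_le gc); [|]; lra.
apply: (le_runinf gc) => // u uP.
have [up|pu] := leP u p; last by apply: vgs; lra.
by apply: le_trans vI _; apply: (runinf_le gc); [|]; lra.
Qed.

(** First half of Pitman's identity. If the running infimum is constant on [[p, r]], take [s = q];
    otherwise take a point where it reaches its value at [r]. *)
Lemma pitman_ineq T g p q r : cont T g -> 0 <= p -> p <= q -> q <= r -> r <= T ->
  exists2 s, p <= s <= r &
    g s <= g q + runinf g p - 2 * runinf g q + runinf g r.
Proof.
move=> gc p0 pq qr rT.
have Iq : runinf g q <= g q by apply: (runinf_le gc); [|]; lra.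
have Iqp : runinf g q <= runinf g p.
  by apply: (runinf_anti gc); [|]; lra.
have pr : 0 <= p <= r by lra.
have qr' : 0 <= q <= r by lra.
have [E|[s sP [E ?]]] := runinf_split gc pr rT; last first.
  by exists s => //; lra.
have := runinf_anti gc qr' rT.
by exists q; [lra | lra].
Qed.

(** Second half of Pitman's identity. If the running infimum drops after [p], take a time at which
    [g] comes back to the level [runinf g p] while the infimum is still there; the left side is then
    [runinf g r]. *)
Lemma pitman_ineq_rev T g p q r :
  cont T g -> 0 <= p -> p <= q -> q <= r -> r <= T ->
  exists2 s, p <= s <= r &
    g s + runinf g p - 2 * runinf g s + runinf g r <= g q.
Proof.
move=> gc p0 pq qr rT.
have pr : 0 <= p <= r by lra.
have Irq : runinf g r <= g q by apply: (runinf_le gc); [|]; lra.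
have [E|[u uP [E uE]]] := runinf_split gc pr rT.
  exists q; first by lra.
  suff -> : runinf g q = runinf g p by lra.
  apply/eqP; rewrite eq_le; apply/andP; split.
    by apply: (runinf_anti gc); [|]; lra.
  by rewrite -E; apply: (runinf_anti gc); [|]; lra.
have [lt|ge] := ltP (runinf g r) (runinf g p).
  have [|s sP [gs Is]] := @first_hit _ _ p r (runinf g p) gc pr rT; first by rewrite lt /=.
  by exists s => //; lra.
exists q; first by lra.
have : runinf g r <= runinf g q by apply: (runinf_anti gc); [|]; lra.
have : runinf g q <= runinf g p by apply: (runinf_anti gc); [|]; lra.
lra.
Qed.

Lemma cont_comb T g h x : cont T g -> cont T h -> cont T (fun t => g t + x * h t).
Proof.
move=> /contP gc /contP hc; apply/contP => t.
have := @continuousD R R^o (subspace `[0,T]%classic) g (fun t => x * h t) t (gc t).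
apply; apply: (@continuousM _ (subspace `[0,T]%classic) (fun=> x) h t _ (hc t)).
exact: cst_continuous.
Qed.

Lemma cont_eq T g h : (forall t, 0 <= t <= T -> g t = h t) -> cont T g -> cont T h.
Proof.
move=> gh gc x xT e e0; have [d d0 dP] := gc x xT e e0.
by exists d => // y yT; rewrite -!gh //; exact: dP.
Qed.

Lemma eq_runinf g h t : (forall s, 0 <= s <= t -> g s = h s) -> runinf g t = runinf h t.
Proof.
by move=> gh; congr inf; apply: eq_imagel => s /=; rewrite in_itv /=; exact: gh.
Qed.

(** Mutually dominated sets have the same lower bounds, and [inf] depends on a non-empty set only
    through these, whether or not any exist. *)
Lemma eq_inf_dominated (A B : set R) :
  (forall x, A x -> exists2 y, B y & y <= x) ->
  (forall x, B x -> exists2 y, A y & y <= x) -> inf A = inf B.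
Proof.
move=> AB BA.
have [A0|/set0P[a Aa]] := eqVneq A set0.
  by congr inf; rewrite A0; apply/seteqP; split=> // b /BA[y]; rewrite A0.
have [b Bb _] := AB _ Aa.
have E : ubound [set - x | x in A] = ubound [set - x | x in B].
  apply/seteqP; split=> z zP _ [x xP <-].
    have [y yP yx] := BA _ xP; apply: (@le_trans _ _ (- y)); first by rewrite lerN2.
    by apply: zP; exists y.
  have [y yP yx] := AB _ xP; apply: (@le_trans _ _ (- y)); first by rewrite lerN2.
  by apply: zP; exists y.
have neg0 (C : set R) c : C c -> ([set - x | x in C] == set0) = false.
  by move=> Cc; apply/negbTE/set0P; exists (- c), c.
by rewrite /inf /sup /supremum (neg0 _ _ Aa) (neg0 _ _ Bb) /supremums E.
Qed.

End RunningInfimum.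

(** * Pitman transforms and chain infima *)

Section Pit.
Context {R : realType} {V : vectType R} (T : R).
Implicit Types (f g : {scalar V}) (al be : V) (p : R -> V).

Lemma scalarN f v : f (- v) = - f v.
Proof. exact: linearN. Qed.

Lemma scalarB f v w : f (v - w) = f v - f w.
Proof. exact: linearB. Qed.

Lemma scalarBZ f v c w : f (v - c *: w) = f v - c * f w.
Proof. by rewrite linearB linearZ. Qed.

(** Stated for any functional and vector, so that it also covers the unfolded graphs; on a simple
    coroot and its root it is convertible to [pitman]. *)
Definition pit f al p : R -> V :=
  on0T T (fun t => p t - runinf (f \o p) t *: al).

Lemma pitE f al p t : 0 <= t <= T -> pit f al p t = p t - runinf (f \o p) t *: al.
Proof. by rewrite /pit /on0T => ->. Qed.

Lemma on0TK p : on0T T (on0T T p) = on0T T p.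
Proof. by apply/funext => t; rewrite /on0T; case: ifP => [->|]. Qed.

Lemma eq_on0T p q : (forall t, 0 <= t <= T -> p t = q t) -> on0T T p = on0T T q.
Proof. by move=> pq; apply/funext => t; rewrite /on0T; case: ifP => [/pq|]. Qed.

Lemma cont_pit f g al p : cont T (f \o p) -> cont T (g \o p) ->
  cont T (g \o pit f al p).
Proof.
move=> fc gc; apply: (@cont_eq _ _ (fun t => g (p t) + (- g al) * runinf (f \o p) t)).
  by move=> t tT /=; rewrite pitE // linearB linearZ /=; ring.
by apply: cont_comb => //; exact: cont_runinf.
Qed.

End Pit.

Section ChainInfimum.
Context {R : realType} {V : vectType R}.
Implicit Types (f g : {scalar V}) (al be : V) (p : R -> V) (s : nat -> R).

(* [cheb a b k.+1] are the coefficients of the roots obtained by alternately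
   applying two simple reflections with off-diagonal Cartan entries -a and -b. *)
Fixpoint cheb (a b : R) (k : nat) : R :=
  match k with
  | 0 => 0
  | k'.+1 => match k' with
    | 0 => 1
    | k''.+1 => (if odd k'' then b else a) * cheb a b k' - cheb a b k''
    end
  end.
Arguments cheb : simpl never.

Lemma chebSS a b k :
  cheb a b k.+2 = (if odd k then b else a) * cheb a b k.+1 - cheb a b k.
Proof. by []. Qed.

(** Chains are infinite sequences, of which [chain_val] reads the entries 1 to [n]; this spares
    index bounds when entries are replaced. *)
Definition chain t s := [/\ s 0 = t, forall k, s k.+1 <= s k & forall k, 0 <= s k].

Lemma chain_le t s k : chain t s -> s k <= t.
Proof. by case=> s0 sS _; elim: k => [|k IH]; [rewrite s0 | exact: le_trans (sS k) IH]. Qed.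

Definition chain_val f g a b n p s : R :=
  \sum_(k < n) cheb a b k.+1 * (if odd k then g else f) (p (s k.+1)).

Definition chain_inf f g a b n p t : R :=
  inf [set chain_val f g a b n p s | s in chain t].

(** Summation by parts. The recurrence of [cheb] turns the corrections that one more transform
    brings to a chain sum into second differences of [I], the form in which Pitman's identity
    applies. *)
Lemma cheb_second_difference a b (I : nat -> R) n :
  \sum_(k < n) cheb a b k.+1 *
      (if odd k == odd n then -2 else if odd k then b else a) * I k.+1
    + (if odd n then 0 else I 0) =
  cheb a b n.+1 * I n + \sum_(k < n)
      (if odd k == odd n then cheb a b k.+1 * (I k.+2 - 2 * I k.+1 + I k) else 0).
Proof.
elim/ltn_ind: n => -[|[|n]] IH.
- by rewrite !big_ord0 /cheb /=; ring.
- by rewrite !big_ord_recl !big_ord0 /cheb /=; ring.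
have := IH n (ltnW (ltnSn n.+1)).
rewrite !big_ord_recr /= !negbK eqxx (chebSS a b n.+1) (chebSS a b n) /=.
have -> : (~~ odd n == odd n) = false by case: odd.
set S1 := \sum_(i < n) _; set S2 := \sum_(i < n) _.
move: S1 S2 (cheb a b n.+1) (cheb a b n) => S1 S2 c1 c0.
by case: (odd n) => /= E; move: E; lra.
Qed.

End ChainInfimum.
Arguments cheb : simpl never.

Section ChainStep.
Context {R : realType} {V : vectType R} (T : R).
Implicit Types (p : R -> V) (s : nat -> R).

Lemma chain_in t s k : 0 <= t <= T -> chain t s -> 0 <= s k <= T.
Proof. by move=> tT cs; have := chain_le k cs; case: cs => _ _ /(_ k); lra. Qed.

Lemma inf_addr (A : set R) c : A !=set0 -> has_lbound A ->
  inf A + c = inf [set x + c | x in A].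
Proof.
move=> [x0 Ax0] Alb; apply/eqP; rewrite eq_le; apply/andP; split.
  apply: lb_le_inf; first by exists (x0 + c), x0.
  by move=> _ [x Ax <-]; rewrite lerD2r; exact: ge_inf.
rewrite -lerBlDr; apply: lb_le_inf; first by exists x0.
move=> x Ax; rewrite lerBlDr; apply: ge_inf; last by exists x.
have [m mP] := Alb; exists (m + c) => _ [y Ay <-].
by rewrite lerD2r; exact: mP.
Qed.

Variables (f g : {scalar V}) (al be : V) (a b : R).
Hypotheses (fal : f al = 2) (gbe : g be = 2) (fbe : f be = - a) (gal : g al = - b).

Local Notation func k := (if odd k then g else f).
Local Notation vect k := (if odd k then be else al).

Variables (n : nat) (p : R -> V) (t : R).
Hypotheses (fc : cont T (f \o p)) (gc : cont T (g \o p)) (tT : 0 <= t <= T).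
Hypothesis cheb_ge0 : forall k, (k <= n)%N -> 0 <= cheb a b k.+1.

Let Z := func n \o p.
Let I := runinf Z.
Let p' := pit T (func n) (vect n) p.

Let Zc : cont T Z. Proof. by rewrite /Z; case: odd. Qed.
Let fc' : cont T (f \o p'). Proof. by apply: cont_pit => //; exact: Zc. Qed.
Let gc' : cont T (g \o p'). Proof. by apply: cont_pit => //; exact: Zc. Qed.

Lemma chain_val_lbound q m : cont T (f \o q) -> cont T (g \o q) ->
  (forall k, (k < m)%N -> 0 <= cheb a b k.+1) ->
  exists M, forall s, chain t s -> M <= chain_val f g a b m q s.
Proof.
move=> fq gq ch0; have T0 : 0 <= T by move: tT; lra.
have [u _ uM] := cont_argmin fq (lexx 0) T0 (lexx T).
have [v _ vM] := cont_argmin gq (lexx 0) T0 (lexx T).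
exists (\sum_(k < m) cheb a b k.+1 * (if odd k then g (q v) else f (q u))) => s cs.
apply: ler_sum => k _; apply: ler_wpM2l; first exact: ch0.
have := chain_in k.+1 tT cs; case: odd; [exact: vM | exact: uM].
Qed.

Lemma chain_val_pit s : chain t s ->
  chain_val f g a b n p' s + (if odd n then 0 else I t) =
  chain_val f g a b n p s + (cheb a b n.+1 * I (s n) + \sum_(k < n)
      (if odd k == odd n then
         cheb a b k.+1 * (I (s k.+2) - 2 * I (s k.+1) + I (s k)) else 0)).
Proof.
move=> cs; have [s0 _ _] := cs.
rewrite -(cheb_second_difference a b (I \o s) n) /= s0 addrA; congr (_ + _).
rewrite /chain_val -big_split /=; apply: eq_bigr => k _.
rewrite -mulrA -mulrDr; congr (_ * _).
rewrite /p' pitE ?(chain_in _ tT cs) //.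
rewrite linearB -/Z -/I; have := I (s k.+1) => x.
case: (odd k); case: (odd n); rewrite /= linearZ /= ?fal ?gbe ?fbe ?gal; ring.
Qed.

(** Every other entry of the chain, namely those at which [Z] is evaluated, is replaced by a time
    between its two neighbours. The neighbours stay fixed, so the choices are independent and the
    result is again a chain. *)
Let swap s u k := if k is k'.+1 then (if odd k' == odd n then u k' else s k) else s 0.

Let swap_chain s u : chain t s -> (forall k, s k.+2 <= u k <= s k) -> chain t (swap s u).
Proof.
move=> [s0 sS sp] us; split=> //.
- case=> [|k] /=.
    by case: ifP => _; [have /andP[] := us 0 | exact: sS].
  have := us k; have := us k.+1; have := sS k.+1.
  by case: (odd n); case: (odd k) => /=; lra.
- case=> [|k] //=; case: ifP => _; last exact: sp.
  by have := sp k.+2; have := us k; lra.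
Qed.

(** Pitman's identity between the entries kept by [swap] trades each second difference of [I] for a
    new minimizing time, one half of the identity for each inequality. The additional term of the
    longer chain comes from [cheb a b n.+1 * I (s n)], an infimum of [Z] up to time [s n]. *)
Lemma chain_inf_step :
  chain_inf f g a b n p' t + (if odd n then 0 else I t) = chain_inf f g a b n.+1 p t.
Proof.
rewrite /chain_inf inf_addr; last 2 first.
- exists (chain_val f g a b n p' (fun=> t)), (fun=> t) => //.
  by split=> // _; move: tT; lra.
- have [|M MP] := @chain_val_lbound p' n fc' gc'; first by move=> k /ltnW; exact: cheb_ge0.
  by exists M => _ [s cs <-]; exact: MP.
apply: eq_inf_dominated.
  move=> _ [_ [s cs <-] <-].
  (* Only the first [n] entries of [s] count. With the later ones at 0, the inequality for index [n]
     says that [Z (u n)] is at most [I (s n)]. *)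
  pose r k := if (k <= n)%N then s k else 0.
  have [s0 sS sp] := cs.
  have rc : chain t r.
    split=> [|k|k]; rewrite /r //; last by case: ifP.
    by case: (ltnP k n) => [kn|nk]; rewrite ?(ltnW kn) //; case: ifP.
  have /choice[u uP] k : exists v, r k.+2 <= v <= r k /\
     Z v <= Z (r k.+1) + I (r k.+2) - 2 * I (r k.+1) + I (r k).
    have [_ rS rp] := rc.
    have [|v vP vZ] := pitman_ineq Zc (rp k.+2) (rS k.+1) (rS k).
      by have := chain_in k tT rc; move: tT; lra.
    by exists v.
  have -> : chain_val f g a b n p' s = chain_val f g a b n p' r.
    by apply: eq_bigr => k _; rewrite /r ltn_ord.
  exists (chain_val f g a b n.+1 p (swap r u)).
    by exists (swap r u) => //; apply: swap_chain => // k; have [] := uP k.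
  rewrite chain_val_pit // /chain_val big_ord_recr /= eqxx.
  rewrite [leRHS]addrA addrAC -big_split /=; apply: lerD.
    apply: ler_sum => k _; have [_] := uP k.
    have ck : 0 <= cheb a b k.+1 by apply: cheb_ge0; exact: ltnW.
    case: eqP => [E|_ _]; last by rewrite addr0.
    rewrite -mulrDr E => uk; apply: ler_wpM2l => //.
    by move: uk; rewrite /Z /=; lra.
  apply: ler_wpM2l; first exact: cheb_ge0.
  have [_] := uP n.
  have -> : r n.+1 = 0 by rewrite /r ltnn.
  have -> : r n.+2 = 0 by rewrite /r leqNgt ltnS leqnSn.
  have : I 0 = Z 0 by apply: (runinf0 Zc); move: tT; lra.
  by rewrite /Z /=; lra.
move=> _ [s cs <-]; have [s0 sS sp] := cs.
have /choice[u uP] k : exists v, s k.+2 <= v <= s k /\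
   Z v + I (s k.+2) - 2 * I v + I (s k) <= Z (s k.+1).
  have [|v vP vZ] := pitman_ineq_rev Zc (sp k.+2) (sS k.+1) (sS k).
    by have := chain_in k tT cs; move: tT; lra.
  by exists v.
have rc : chain t (swap s u) by apply: swap_chain => // k; have [] := uP k.
have swapE k : odd k == odd n -> swap s u k = s k.
  by case: k => [|k] //=; case: (odd k); case: (odd n).
exists (chain_val f g a b n p' (swap s u) + (if odd n then 0 else I t)).
  by exists (chain_val f g a b n p' (swap s u)) => //; exists (swap s u).
rewrite chain_val_pit // /chain_val big_ord_recr /=.
rewrite [leLHS]addrA addrAC -big_split /=; apply: lerD.
  apply: ler_sum => k _; have [_] := uP k.
  have ck : 0 <= cheb a b k.+1 by apply: cheb_ge0; exact: ltnW.
  case: eqP => [E|_ _]; last by rewrite addr0.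
  rewrite -mulrDr E => uk; apply: ler_wpM2l => //.
  have -> : (~~ odd n == odd n) = false by case: odd.
  rewrite swapE ?E //; move: uk; rewrite /Z /=; lra.
apply: ler_wpM2l; first exact: cheb_ge0.
rewrite swapE //; apply: (runinf_le Zc); last by have := chain_in n tT cs; move: tT; lra.
by have := sp n.+1; have := sS n; lra.
Qed.

End ChainStep.

Section AlternatingWords.
Context {R : realType} {V : vectType R} (T : R).
Implicit Types (f g : {scalar V}) (al be : V) (p : R -> V).

(** The outermost transform is always the one along [f]; the recursion peels off the innermost one,
    which depends on the parity of [n], because [chain_inf_step] absorbs that one. *)
Fixpoint alt_pit f al g be n p : R -> V :=
  if n is n'.+1 then
    alt_pit f al g be n'
      (pit T (if odd n' then g else f) (if odd n' then be else al) p)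
  else p.

Lemma chain_inf0 f g a b p t : 0 <= t -> chain_inf f g a b 0 p t = 0.
Proof.
move=> t0; rewrite /chain_inf -[RHS](inf1 (0 : R)); congr inf; apply/seteqP; split=> x.
  by case=> s _ <-; rewrite /chain_val big_ord0.
by move=> ->; exists (fun=> t); [split | rewrite /chain_val big_ord0].
Qed.

Lemma alt_pitE f al g be a b n p t :
  f al = 2 -> g be = 2 -> f be = - a -> g al = - b ->
  cont T (f \o p) -> cont T (g \o p) -> 0 <= t <= T ->
  (forall k, (k < n)%N -> 0 <= cheb a b k.+1) ->
  (forall k, (k < n)%N -> 0 <= cheb b a k.+1) ->
  alt_pit f al g be n p t =
  p t - chain_inf f g a b n p t *: al - chain_inf g f b a n.-1 p t *: be.
Proof.
move=> fal gbe fbe gal + + tT.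
elim: n p => [|n IH] p fc gc ca cb.
  by rewrite /= !chain_inf0 ?scale0r ?subr0 //; move: tT; lra.
have cp (h : {scalar V}) : cont T (h \o p) ->
    cont T (h \o pit T (if odd n then g else f) (if odd n then be else al) p).
  by move=> hc; apply: cont_pit => //; case: odd.
have ca' k : (k < n)%N -> 0 <= cheb a b k.+1 by move=> /ltnW; exact: ca.
have cb' k : (k < n)%N -> 0 <= cheb b a k.+1 by move=> /ltnW; exact: cb.
rewrite /= IH ?pitE //; try exact: cp.
have := chain_inf_step fal gbe fbe gal fc gc tT ca.
have -> : chain_inf g f b a n p t =
  chain_inf g f b a n.-1 (pit T (if odd n then g else f) (if odd n then be else al) p) t
  + (if odd n then runinf (g \o p) t else 0).
  case: n ca cb {IH cp ca'} cb' => [|n] ca cb cb' /=.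
    by rewrite !chain_inf0 ?addr0 //; move: tT; lra.
  have := chain_inf_step gbe fal gal fbe gc fc tT cb'.
  by case: (odd n) => /= <-.
move=> <-; case: (odd n) => /=; rewrite ?addr0 scalerDl !opprD !addrA.
  by rewrite -!addrA; congr (_ + _); rewrite addrCA; congr (_ + _); rewrite addrC.
by rewrite -!addrA; congr (_ + _); rewrite addrCA.
Qed.

(** At the order of the braid relation the chains lose their last term, which makes the two
    coefficients in [alt_pitE] symmetric. *)
Lemma chain_inf_cheb0 f g a b n p t : cheb a b n.+1 = 0 ->
  chain_inf f g a b n.+1 p t = chain_inf f g a b n p t.
Proof.
move=> c0; congr inf; apply: eq_imagel => s _.
by rewrite /chain_val big_ord_recr /= c0 mul0r addr0.
Qed.

Lemma alt_pit_braid f al g be a b m p t :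
  f al = 2 -> g be = 2 -> f be = - a -> g al = - b ->
  cont T (f \o p) -> cont T (g \o p) -> 0 <= t <= T ->
  (forall k, (k < m)%N -> 0 <= cheb a b k.+1) ->
  (forall k, (k < m)%N -> 0 <= cheb b a k.+1) ->
  cheb a b m = 0 -> cheb b a m = 0 ->
  alt_pit f al g be m p t = alt_pit g be f al m p t.
Proof.
case: m => [|m] // fal gbe fbe gal fc gc tT ca cb c0 c0'.
rewrite (alt_pitE fal gbe fbe gal) // (alt_pitE gbe fal gal fbe) //=.
by rewrite !chain_inf_cheb0 // addrAC.
Qed.

End AlternatingWords.

(** * Words in the transforms and their string coordinates *)

Section PitWords.
Context {R : realType} {V : vectType R} (T : R) {X : Type}.
Variables (F : X -> {scalar V}) (A : X -> V).
Implicit Types (p : R -> V) (u v : seq X).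

Definition pit_word u p : R -> V := foldr (fun i => pit T (F i) (A i)) p u.

Lemma pit_word_cat u v p : pit_word (u ++ v) p = pit_word u (pit_word v p).
Proof. exact: foldr_cat. Qed.

Lemma pit_word_rcons u i p : pit_word (rcons u i) p = pit_word u (pit T (F i) (A i) p).
Proof. by rewrite -cats1 pit_word_cat. Qed.

Fixpoint alt_word (i j : X) n : seq X := if n is n'.+1 then i :: alt_word j i n' else [::].

Lemma size_alt_word i j n : size (alt_word i j n) = n.
Proof. by elim: n i j => //= n IH i j; rewrite IH. Qed.

Lemma alt_wordSr i j n :
  alt_word i j n.+1 = rcons (alt_word i j n) (if odd n then j else i).
Proof.
elim: n i j => [|n IH] i j //.
by rewrite [LHS]/= -/(alt_word _ _ n.+1) IH /=; case: odd.
Qed.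

Lemma pit_alt_word i j n p :
  pit_word (alt_word i j n) p = alt_pit T (F i) (A i) (F j) (A j) n p.
Proof.
elim: n p => // n IH p.
by rewrite alt_wordSr pit_word_rcons IH /=; case: odd.
Qed.

(* The string coordinates of [p] along the word (the number of times each
   transform moves the end point by a root) are integers. *)
Fixpoint string_int u p : Prop :=
  if u is i :: v then
    string_int v p /\ runinf (F i \o pit_word v p) T \is a Num.int
  else True.

Lemma string_int_cat u v p :
  string_int (u ++ v) p <-> string_int v p /\ string_int u (pit_word v p).
Proof.
elim: u => [|i u IH] /=; first by tauto.
by rewrite pit_word_cat; tauto.
Qed.

Lemma string_int_rcons u i p : string_int (rcons u i) p <->
  runinf (F i \o p) T \is a Num.int /\ string_int u (pit T (F i) (A i) p).
Proof. by rewrite -cats1 string_int_cat /=; tauto. Qed.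

End PitWords.

(** * Braid relations and integrality of strings *)

Section BraidRelations.
Context {R : realType} {V : vectType R} (T : R) {X : Type}.
Variables (F : X -> {scalar V}) (A : X -> V).
Hypothesis FA : forall i, F i (A i) = 2.
Hypothesis T0 : 0 <= T.
Implicit Types (p : R -> V) (u v w : seq X).

Local Notation pitw := (pit_word T F A).
Local Notation strint := (string_int T F A).

Definition coroot_cont p := forall i, cont T (F i \o p).

Lemma coroot_cont_pit i p : coroot_cont p -> coroot_cont (pit T (F i) (A i) p).
Proof. by move=> pc j; apply: cont_pit. Qed.

Lemma coroot_cont_word u p : coroot_cont p -> coroot_cont (pitw u p).
Proof. by move=> pc; elim: u => //= i u; exact: coroot_cont_pit. Qed.

(** Both properties are carried together because Matsumoto's theorem must transport integrality of
    strings as well as the transforms; quantifying over [p] makes the relation a congruence for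
    concatenation. *)
Definition braid_equiv u v := forall p, coroot_cont p ->
  pitw u p = pitw v p /\ (strint u p <-> strint v p).

Lemma braid_equiv_refl u : braid_equiv u u.
Proof. by []. Qed.

Lemma braid_equiv_sym u v : braid_equiv u v -> braid_equiv v u.
Proof. by move=> uv p /uv[-> uvp]; split=> //; tauto. Qed.

Lemma braid_equiv_trans v u w : braid_equiv u v -> braid_equiv v w -> braid_equiv u w.
Proof. by move=> uv vw p pc; have [-> ?] := uv p pc; have [-> ?] := vw p pc; split=> //; tauto. Qed.

Lemma braid_equiv_cat x u v y : braid_equiv u v -> braid_equiv (x ++ u ++ y) (x ++ v ++ y).
Proof.
move=> uv p pc; rewrite !pit_word_cat !string_int_cat !pit_word_cat.
have [-> E] := uv _ (coroot_cont_word y pc); split=> //; tauto.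
Qed.

Lemma pit_word_supp u p : (0 < size u)%N -> on0T T (pitw u p) = pitw u p.
Proof. by case: u => // i u _; exact: on0TK. Qed.

Lemma pit_word_alt_eq i j (a b : R) m : F i (A j) = - a -> F j (A i) = - b ->
  (forall k, (k < m)%N -> 0 <= cheb a b k.+1) ->
  (forall k, (k < m)%N -> 0 <= cheb b a k.+1) ->
  cheb a b m = 0 -> cheb b a m = 0 ->
  forall p, coroot_cont p -> pitw (alt_word i j m) p = pitw (alt_word j i m) p.
Proof.
case: m => // m fa fb ca cb c0 c0' p pc.
rewrite -[LHS]pit_word_supp ?size_alt_word // -[RHS]pit_word_supp ?size_alt_word //.
apply: eq_on0T => t tT.
by rewrite -!/(alt_word _ _ m.+1) !pit_alt_word; apply: alt_pit_braid c0 c0'.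
Qed.

Lemma chain_inf1 (f g : {scalar V}) (a b : R) p t : cont T (f \o p) -> 0 <= t <= T ->
  chain_inf f g a b 1 p t = runinf (f \o p) t.
Proof.
move=> fc tT; have [s sP [-> sM]] := runinf_attained fc tT.
have val r : chain_val f g a b 1 p r = f (p (r 1)).
  by rewrite /chain_val big_ord_recl big_ord0 /cheb /= mul1r addr0.
have tc : chain t (fun k => if k is 0 then t else s) by split=> [//|[|k]|[|k]]; lra.
apply/eqP; rewrite eq_le; apply/andP; split.
  apply: ge_inf; last by exists (fun k => if k is 0 then t else s); rewrite ?val.
  exists (f (p s)) => _ [r rc <-]; rewrite val; apply: sM.
  by have := chain_le 1 rc; case: rc => _ _ /(_ 1); lra.
apply: lb_le_inf; first by eexists; eexists; first exact: tc.
move=> _ [r rc <-]; rewrite val; apply: sM.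
by have := chain_le 1 rc; case: rc => _ _ /(_ 1); lra.
Qed.

(* Sums of infima split according to the order of the two minimizing times:
   the tropical Pluecker relation of type A2. *)
Lemma chain_inf_pluecker (f g : {scalar V}) p : cont T (f \o p) -> cont T (g \o p) ->
  runinf (f \o p) T + runinf (g \o p) T =
  Num.min (chain_inf f g 1 1 2 p T) (chain_inf g f 1 1 2 p T).
Proof.
have TT : 0 <= T <= T by rewrite T0 lexx.
have val (f' g' : {scalar V}) r : chain_val f' g' 1 1 2 p r = f' (p (r 1)) + g' (p (r 2)).
  by rewrite /chain_val !big_ord_recl big_ord0 /cheb /= !mul1r; ring.
have ub (f' g' : {scalar V}) s r : cont T (f' \o p) -> cont T (g' \o p) ->
    0 <= r -> r <= s -> s <= T -> chain_inf f' g' 1 1 2 p T <= f' (p s) + g' (p r).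
  move=> fc gc r0 rs sT; apply: ge_inf; last first.
    exists (fun k => if k is k'.+1 then if k' is 0 then s else r else T); rewrite ?val //.
    by split=> [//|[|[|k]]|[|[|k]]]; lra.
  exists (runinf (f' \o p) T + runinf (g' \o p) T) => _ [x xc <-]; rewrite val.
  apply: lerD; [apply: (runinf_le fc)|apply: (runinf_le gc)] => //.
    by have := chain_in 1 TT xc; lra.
  by have := chain_in 2 TT xc; lra.
have lb (f' g' : {scalar V}) : cont T (f' \o p) -> cont T (g' \o p) ->
    runinf (f' \o p) T + runinf (g' \o p) T <= chain_inf f' g' 1 1 2 p T.
  move=> fc gc; apply: lb_le_inf.
    by eexists; exists (fun=> T).
  move=> _ [x xc <-]; rewrite val.
  apply: lerD; [apply: (runinf_le fc)|apply: (runinf_le gc)] => //.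
    by have := chain_in 1 TT xc; lra.
  by have := chain_in 2 TT xc; lra.
move=> fc gc; apply/eqP; rewrite eq_le le_min lb //= addrC lb //=.
have [s sP [-> _]] := runinf_attained fc TT.
have [r rP [-> _]] := runinf_attained gc TT.
rewrite ge_min /=; apply/orP; have [rs|sr] := leP r s.
  by left; rewrite addrC; apply: ub => //; lra.
by right; apply: ub => //; lra.
Qed.

(** Comparing the end points given by [alt_pitE] for [n] and [n.+1] letters isolates the coefficient
    of [A i]: string coordinates of alternating words are differences of chain infima. *)
Lemma runinf_alt_pit i j (a b : R) n p :
  F i (A j) = - a -> F j (A i) = - b -> coroot_cont p ->
  (forall k, (k <= n)%N -> 0 <= cheb a b k.+1) ->
  (forall k, (k <= n)%N -> 0 <= cheb b a k.+1) ->
  runinf (F i \o pitw (alt_word j i n) p) T =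
  chain_inf (F i) (F j) a b n.+1 p T - chain_inf (F i) (F j) a b n.-1 p T.
Proof.
have TT : 0 <= T <= T by rewrite T0 lexx.
move=> fa fb pc ca cb.
have ca' k : (k < n)%N -> 0 <= cheb a b k.+1 by move=> /ltnW; exact: ca.
have cb' k : (k < n)%N -> 0 <= cheb b a k.+1 by move=> /ltnW; exact: cb.
have e1 : pit T (F i) (A i) (pitw (alt_word j i n) p) T =
    p T - chain_inf (F i) (F j) a b n.+1 p T *: A i - chain_inf (F j) (F i) b a n p T *: A j.
  rewrite -(alt_pitE (n := n.+1) (FA i) (FA j) fa fb (pc i) (pc j) TT ca cb).
  by rewrite -pit_alt_word.
have e2 : pitw (alt_word j i n) p T =
    p T - chain_inf (F j) (F i) b a n p T *: A j - chain_inf (F i) (F j) a b n.-1 p T *: A i.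
  rewrite -(alt_pitE (n := n) (FA j) (FA i) fb fa (pc j) (pc i) TT cb' ca').
  by rewrite -pit_alt_word.
move: e1; rewrite pitE // {1}e2 => /(congr1 (F i)).
rewrite !scalarBZ FA; lra.
Qed.

Lemma braid_equiv2 i j : F i (A j) = 0 -> F j (A i) = 0 ->
  braid_equiv [:: i; j] [:: j; i].
Proof.
move=> ij ji p pc; split.
  have c k : (k < 2)%N -> 0 <= cheb 0 0 k.+1 :> R.
    by case: k => [|[|]] // _; rewrite /cheb /=; lra.
  apply: (pit_word_alt_eq (a := 0) (b := 0) (m := 2)) => //; rewrite ?oppr0 //.
    by rewrite /cheb /=; ring.
  by rewrite /cheb /=; ring.
rewrite /=.
have E k l : F l (A k) = 0 ->
    runinf (F l \o pit T (F k) (A k) p) T = runinf (F l \o p) T.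
  move=> kl; apply: eq_runinf => s sP /=.
  by rewrite pitE // linearB linearZ /= kl mulr0 subr0.
by rewrite !E //; tauto.
Qed.

(** Write I_k for the infimum of [F k] along the path and M_kl for the chain infimum of length two
    starting with [F k]. The string coordinates of k l k are I_k, M_lk and M_kl - I_k; the relation
    I_k + I_l = min(M_kl, M_lk) then gives I_l, and with it the coordinates of l k l. *)
Lemma braid_equiv3 i j : F i (A j) = -1 -> F j (A i) = -1 ->
  braid_equiv [:: i; j; i] [:: j; i; j].
Proof.
have c k : (k < 3)%N -> 0 <= cheb 1 1 k.+1 :> R.
  by case: k => [|[|[|]]] // _; rewrite /cheb /=; lra.
have c3 : cheb 1 1 3 = 0 :> R by rewrite /cheb /=; ring.
have TT : 0 <= T <= T by rewrite T0 lexx.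
move=> ij ji p pc; split.
  by apply: (pit_word_alt_eq (a := 1) (b := 1) (m := 3)).
suff H k l : F k (A l) = -1 -> F l (A k) = -1 ->
    strint [:: k; l; k] p -> strint [:: l; k; l] p by split; exact: H.
move=> kl lk [[[_ h1] h2] h3].
have r1 := runinf_alt_pit (n := 1) kl lk pc; have r1' := runinf_alt_pit (n := 1) lk kl pc.
have r2 := runinf_alt_pit (n := 2) kl lk pc; have r2' := runinf_alt_pit (n := 2) lk kl pc.
rewrite /= !chain_inf0 // ?subr0 in r1 r1'.
rewrite /= !(@chain_inf_cheb0 _ _ _ _ _ _ 2 _ _ c3) !chain_inf1 // in r2 r2'.
have P := chain_inf_pluecker (pc k) (pc l).
move: h1 h2 h3; rewrite /= r1' ?r2; do ?[by move=> m mn; apply: c; exact: leq_trans mn _].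
rewrite /= in P * => h1 h2 h3.
have h4 : chain_inf (F k) (F l) 1 1 2 p T \is a Num.int.
  by rewrite -(subrK (runinf (F k \o p) T) (chain_inf _ _ _ _ _ _ _)) rpredD.
have h5 : runinf (F l \o p) T \is a Num.int.
  rewrite -(addrK (runinf (F k \o p) T) (runinf _ _)) addrC [_ + runinf (F k \o p) T]addrC P.
  by rewrite addrC rpredB //; case: leP.
split; first split; first split => //.
  by rewrite r1 // => m mn; apply: c; exact: leq_trans mn _.
by rewrite r2' ?rpredB // => m mn; apply: c; exact: leq_trans mn _.
Qed.

End BraidRelations.

(** * Folding the star graphs A3 and D4 *)

Section StarGraph.
Context {R : realType} (T : R) (l : nat).
Hypothesis T0 : 0 <= T.

(* A vector is recorded by its values on the simple coroots; vertex 0 is the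
   center of the star. *)
Local Notation V := {ffun 'I_l.+1 -> R^o}.

Definition star_cartan (i j : nat) : R :=
  if i == j then 2 else if (i == 0%N) != (j == 0%N) then -1 else 0.

Definition star_coroot (k : nat) (v : V) : R := v (inord k).

Fact star_coroot_is_linear k : linear_for *%R (star_coroot k).
Proof. by move=> c u v; rewrite /star_coroot !ffunE. Qed.

HB.instance Definition _ k :=
  GRing.isLinear.Build R V R *%R (star_coroot k) (star_coroot_is_linear k).

Definition star_root (k : nat) : V :=
  [ffun j : 'I_l.+1 => star_cartan j (inord k : 'I_l.+1)].

Definition star_fun k : {scalar V} := star_coroot k.

Lemma star_funE i j : (i <= l)%N -> (j <= l)%N ->
  star_fun i (star_root j) = star_cartan i j.
Proof. by move=> il jl; rewrite /star_fun /= /star_coroot ffunE !inordK. Qed.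

Lemma star_fun_self i : star_fun i (star_root i) = 2.
Proof. by rewrite /star_fun /= /star_coroot ffunE /star_cartan eqxx. Qed.

Local Notation star_equiv := (braid_equiv T star_fun star_root).
Local Notation star_pit := (pit_word T star_fun star_root).
Local Notation star_int := (string_int T star_fun star_root).

(** A braid move at position [k], or no change where none applies. Being computable, it lets a list
    of moves be checked by evaluation. *)
Definition star_move (w : seq nat) (k : nat) : seq nat :=
  take k w ++
  match drop k w with
  | i :: j :: y =>
    if [&& (i <= l)%N, (j <= l)%N & i != j] then
      if (i == 0%N) == (j == 0%N) then j :: i :: y
      else if y is i' :: y' then
        if i' == i then j :: i :: j :: y' else i :: j :: y
      else i :: j :: y
    else i :: j :: y
  | y => y
  end.

Lemma star_move_equiv w k : star_equiv w (star_move w k).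
Proof.
rewrite -{1}(cat_take_drop k w) /star_move.
case: (drop k w) => [|i [|j y]]; try exact: braid_equiv_refl.
case: ifP => [/and3P[il jl ij]|_]; last exact: braid_equiv_refl.
case: ifPn => [/eqP E|E].
  apply: (@braid_equiv_cat _ _ _ _ _ _ _ [:: i; j] [:: j; i]).
  apply: braid_equiv2; rewrite ?star_funE //; first exact: star_fun_self.
    by rewrite /star_cartan (negbTE ij) E eqxx.
  by rewrite /star_cartan eq_sym (negbTE ij) E eqxx.
case: y => [|i' y]; first exact: braid_equiv_refl.
case: eqP => [->|_]; last exact: braid_equiv_refl.
apply: (@braid_equiv_cat _ _ _ _ _ _ _ [:: i; j; i] [:: j; i; j]).
apply: braid_equiv3; rewrite ?star_funE //; first exact: star_fun_self.
  by rewrite /star_cartan (negbTE ij) E.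
by rewrite /star_cartan eq_sym (negbTE ij) eq_sym E.
Qed.

Lemma star_moves_equiv ks w : star_equiv w (foldl star_move w ks).
Proof.
elim: ks w => [|k ks IH] w /=; first exact: braid_equiv_refl.
exact: braid_equiv_trans (star_move_equiv w k) (IH _).
Qed.

(** Distinct leaves are orthogonal: a transform at one leaf does not change the infima at the
    others, so the corrections add up. *)
Lemma star_pit_leaves (s : seq nat) q : uniq s -> all (fun k => 0 < k <= l)%N s ->
  coroot_cont T star_fun q ->
  (forall t (j : 'I_l.+1), 0 <= t <= T ->
     star_pit s q t j = q t j - \sum_(k <- s) star_cartan j k * runinf (star_fun k \o q) t)
  /\ (star_int s q <->
      forall k, k \in s -> runinf (star_fun k \o q) T \is a Num.int).
Proof.
move=> + + qc; elim: s => [|k s IH] /=.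
  by move=> _ _; split=> // t j _; rewrite big_nil subr0.
move=> /andP[ks us] /andP[/andP[k0 kl] sl]; have {IH}[IH1 IH2] := IH us sl.
have E t : 0 <= t <= T ->
    runinf (star_fun k \o star_pit s q) t = runinf (star_fun k \o q) t.
  move=> tT; apply: eq_runinf => x xt; rewrite /= /star_coroot IH1; last by lra.
  rewrite big_seq big1 ?subr0 // => j js; rewrite inordK // /star_cartan.
  case: eqP => [kj|_]; first by rewrite kj js in ks.
  have /andP[j0 _] := allP sl _ js.
  by rewrite -[k == _]negbK -lt0n k0 -[j == _]negbK -lt0n j0 mul0r.
split=> [t j tT|].
  rewrite big_cons pitE // !ffunE IH1 // E // inordK //.
  by rewrite mulrC opprD addrAC addrA.
rewrite E ?T0 ?lexx //; split=> [[/IH2 H h] j|H].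
  by rewrite inE => /orP[/eqP->|/H].
by split; [apply/IH2 => j js; apply: H; rewrite inE js orbT | apply: H; rewrite inE eqxx].
Qed.

End StarGraph.

(** * Lifting rank two paths to symmetric paths on a star graph *)

Section Folding.
Context {R : realType} {V : vectType R} (T : R) (l : nat).
Hypothesis T0 : 0 <= T.
Variables (f g : {scalar V}) (al be : V).
Hypotheses (fal : f al = 2) (gbe : g be = 2) (fbe : f be = -1) (gal : g al = - l%:R).

Let F (b : bool) : {scalar V} := if b then g else f.
Let A (b : bool) : V := if b then be else al.

Definition fold_lift (p : R -> V) : R -> {ffun 'I_l.+1 -> R^o} :=
  fun t => [ffun j : 'I_l.+1 => if j == 0%N :> nat then g (p t) else f (p t)].

Definition fold_word (w : seq bool) : seq nat :=
  flatten [seq if b then [:: 0%N] else iota 1 l | b <- w].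

Hypothesis l0 : (0 < l)%N.

Lemma fold_lift_cont p : coroot_cont T F p -> coroot_cont T (@star_fun R l) (fold_lift p).
Proof.
move=> pc k; have [E|E] := eqVneq (nat_of_ord (inord k : 'I_l.+1)) 0%N.
  by apply: cont_eq (pc true) => t _; rewrite /= /star_coroot ffunE E.
by apply: cont_eq (pc false) => t _; rewrite /= /star_coroot ffunE (negbTE E).
Qed.

(** The transform along [f] lifts to the product of all leaf transforms, whose Cartan entries -1 at
    the centre add up to [- l%:R], the value of [g al]. The one along [g] lifts to the centre, with
    entry -1 at each leaf, the value of [f be]. *)
Lemma fold_step b p : coroot_cont T F p ->
  pit_word T (@star_fun R l) (@star_root R l) (fold_word [:: b]) (fold_lift p)
    = fold_lift (pit T (F b) (A b) p) /\
  (string_int T (@star_fun R l) (@star_root R l) (fold_word [:: b]) (fold_lift p)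
    <-> runinf (F b \o p) T \is a Num.int).
Proof.
move=> pc; have qc := fold_lift_cont pc.
have supp : fold_lift (pit T (F b) (A b) p) = on0T T (fold_lift (pit T (F b) (A b) p)).
  apply/funext => t; rewrite /on0T; case: ifPn => // /negbTE tT.
  by apply/ffunP => j; rewrite !ffunE /pit /on0T tT !linear0; case: ifP.
have ev k t : (k <= l)%N -> runinf (star_fun l k \o fold_lift p) t =
    runinf ((if k == 0%N then g else f) \o p) t.
  by move=> kl; apply: eq_runinf => s _; rewrite /= /star_coroot ffunE inordK //; case: eqP.
rewrite /fold_word /= cats0; case: b supp => supp.
  split; last by rewrite /= ev //=; tauto.
  rewrite supp /=; apply: eq_on0T => t tT; apply/ffunP => j.
  rewrite !ffunE pitE // ev // inordK //= !scalarBZ gbe fbe /star_cartan.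
  rewrite -[_ *: _]/(_ * _).
  by case: eqP => // /eqP; case: (j : nat) => //= n _; ring.
have us : uniq (iota 1 l) by exact: iota_uniq.
have sl : all (fun k => 0 < k <= l)%N (iota 1 l) by apply/allP => k; rewrite mem_iota; lia.
have [H1 H2] := star_pit_leaves T0 us sl qc.
split; last first.
  rewrite H2; split=> [/(_ 1%N)|H k].
    by rewrite mem_iota ev //; apply; lia.
  rewrite mem_iota => kl; rewrite ev; last by lia.
  by case: eqP kl => [->|].
rewrite supp -[LHS]pit_word_supp ?size_iota //.
apply: eq_on0T => t tT; apply/ffunP => j; rewrite H1 // !ffunE pitE // !scalarBZ fal gal.
have -> : \sum_(k <- iota 1 l) star_cartan j k * runinf (star_fun l k \o fold_lift p) t =
    \sum_(k <- iota 1 l) star_cartan j k * runinf (f \o p) t.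
  apply: eq_big_seq => k; rewrite mem_iota => kl; rewrite ev; last by lia.
  by case: eqP kl => [->|].
rewrite -mulr_suml; have [j0|j0] := eqVneq (nat_of_ord j) 0%N.
  rewrite (eq_big_seq (fun=> -1)).
    by rewrite big_const_seq count_predT size_iota iter_addr_0 mulrN mulNrn -mulNrn; ring.
  by move=> k; rewrite mem_iota j0 => kl; rewrite /star_cartan; case: k kl.
have jl : nat_of_ord j \in iota 1 l by rewrite mem_iota; have := ltn_ord j; lia.
rewrite (bigD1_seq (nat_of_ord j) jl (iota_uniq _ _)) /=.
rewrite big_seq_cond big1 => [|k].
  by rewrite /star_cartan eqxx; ring.
rewrite mem_iota => /andP[kl kj]; rewrite /star_cartan eq_sym (negbTE kj) (negbTE j0).
by case: k kl {kj}.
Qed.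

Lemma fold_pit_word w p : coroot_cont T F p ->
  pit_word T (@star_fun R l) (@star_root R l) (fold_word w) (fold_lift p)
    = fold_lift (pit_word T F A w p) /\
  (string_int T (@star_fun R l) (@star_root R l) (fold_word w) (fold_lift p)
    <-> string_int T F A w p).
Proof.
move=> pc; elim: w => [|b w [IH1 IH2]]; first by [].
have wc : coroot_cont T F (pit_word T F A w p) by exact: coroot_cont_word.
have -> : fold_word (b :: w) = fold_word [:: b] ++ fold_word w by rewrite /fold_word /= cats0.
have [h1 h2] := fold_step b wc.
rewrite pit_word_cat string_int_cat IH1; split=> //.
by rewrite IH2 h2.
Qed.

Lemma fold_string_int ks w w' : foldl (star_move l) (fold_word w) ks = fold_word w' ->
  forall p, coroot_cont T F p -> string_int T F A w p <-> string_int T F A w' p.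
Proof.
move=> E p pc; have [_ <-] := fold_pit_word w pc; have [_ <-] := fold_pit_word w' pc.
rewrite -E; have := star_moves_equiv (l := l) T0 ks (fold_word w).
by move=> /(_ _ (fold_lift_cont pc))[].
Qed.



End Folding.

(** * Classification of the finite rank two types *)

Section RankTwo.
Context {R : realType}.

(** The second conjunct is the inductive invariant: it makes the next term at least half of its
    leading product, hence positive, and [4 <= a * b] reproduces it with [a] and [b] exchanged. *)
Lemma cheb_gt0 (a b : R) k : 0 < a -> 0 < b -> 4 <= a * b ->
  0 < cheb a b k.+1 /\ 2 * cheb a b k <= (if odd k then b else a) * cheb a b k.+1.
Proof.
move=> a0 b0 ab; elim: k => [|k [IH1 IH2]]; first by rewrite /cheb /=; lra.
rewrite chebSS /=; set e := cheb a b k.+1 in IH1 IH2 *; set d := cheb a b k in IH2 *.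
by case: (odd k) IH2 => /= IH2; nra.
Qed.

(** By [cheb_gt0] a vanishing coefficient forces [a * b < 4]; for each remaining pair the signs of
    the coefficients leave a single [m]. *)
Lemma rank_two_cases (a b m : nat) : (0 < m)%N ->
  (forall k, (k < m)%N -> 0 <= cheb a%:R b%:R k.+1 :> R) ->
  (forall k, (k < m)%N -> 0 <= cheb b%:R a%:R k.+1 :> R) ->
  cheb a%:R b%:R m = 0 :> R -> cheb b%:R a%:R m = 0 :> R ->
  (a, b, m) \in [:: (0, 0, 2); (1, 1, 3); (1, 2, 4); (2, 1, 4); (1, 3, 6); (3, 1, 6)]%N.
Proof.
move=> m0 ca cb c0 c0'.
have [a0|a0] := posnP a.
  subst a; have m2 : (m <= 2)%N.
    rewrite leqNgt; apply/negP => /ca; rewrite /cheb /=; lra.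
  case: m m0 m2 c0 c0' {ca cb} => [|[|[|m]]] //= _ _; rewrite /cheb /=; first by lra.
  move=> _; rewrite mulr1 subr0 => /eqP; rewrite pnatr_eq0 => /eqP -> //.
have [b0|b0] := posnP b.
  subst b; have m2 : (m <= 2)%N.
    rewrite leqNgt; apply/negP => /cb; rewrite /cheb /=; lra.
  case: m m0 m2 c0 c0' {ca cb} => [|[|[|m]]] //= _ _; rewrite /cheb /=; first by lra.
  rewrite mulr1 subr0 => /eqP; rewrite pnatr_eq0 => /eqP a00; by rewrite a00 in a0.
have [ab|ab] := leqP 4 (a * b).
  have : 4 <= a%:R * b%:R :> R by rewrite -natrM ler_nat.
  have a1 : 0 < a%:R :> R by rewrite ltr0n.
  have b1 : 0 < b%:R :> R by rewrite ltr0n.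
  move=> /(cheb_gt0 m.-1 a1 b1)[]; rewrite prednK // c0; lra.
have abE : (a, b) \in [:: (1, 1); (1, 2); (2, 1); (1, 3); (3, 1)]%N.
  have a4 : (a < 4)%N by nia.
  have b4 : (b < 4)%N by nia.
  by move: a a4 b b4 ab a0 b0 {ca cb c0 c0'} => [|[|[|[|a]]]] // _ [|[|[|[|b]]]].
(* A negative coefficient bounds [m], leaving finitely many values to test. *)
have bound n : cheb a%:R b%:R n.+1 < 0 :> R -> (m <= n)%N.
  by move=> cn; rewrite leqNgt; apply/negP => /ca; lra.
move: abE; rewrite !inE => /or4P[||| /orP[|]] /eqP[? ?]; subst a b;
  [have := bound 3 | have := bound 4 | have := bound 4 | have := bound 6 | have := bound 6];
  rewrite {1}/cheb /= => /(_ ltac:(lra)) mn {ca cb bound};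
  move: m m0 c0 c0' mn => [|[|[|[|[|[|[|m]]]]]]] //= _; rewrite /cheb /=; lra.
Qed.

Lemma string_int_map {V : vectType R} (T : R) {X Y : Type} (h : Y -> X)
    (F : X -> {scalar V}) (A : X -> V) w p :
  pit_word T F A (map h w) p = pit_word T (F \o h) (A \o h) w p /\
  (string_int T F A (map h w) p <-> string_int T (F \o h) (A \o h) w p).
Proof. by elim: w => //= y w [E1 E2]; rewrite E1; tauto. Qed.

Lemma map_alt_word {X Y : Type} (h : Y -> X) i j n :
  map h (alt_word i j n) = alt_word (h i) (h j) n.
Proof. by elim: n i j => //= n IH i j; rewrite IH. Qed.

End RankTwo.

Section RankTwoBraid.
Context {R : realType} {V : vectType R} (T : R) {X : Type}.
Variables (F : X -> {scalar V}) (A : X -> V).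
Hypothesis FA : forall i, F i (A i) = 2.
Hypothesis T0 : 0 <= T.

(* Types B2 (l = 2) and G2 (l = 3) are folded from A3 and D4; [ks] lists the
   positions of braid moves relating the two unfolded words, and the instances
   below were found by breadth-first search. *)
Lemma string_int_fold i j l m ks : (0 < l)%N ->
  F i (A j) = -1 -> F j (A i) = - l%:R ->
  foldl (star_move l) (fold_word l (alt_word false true m)) ks =
    fold_word l (alt_word true false m) ->
  forall p, coroot_cont T F p ->
  string_int T F A (alt_word i j m) p <-> string_int T F A (alt_word j i m) p.
Proof.
move=> l0 ij ji E p pc.
pose h (b : bool) := if b then j else i.
have [_ H] := string_int_map T h F A (alt_word false true m) p.
have [_ H'] := string_int_map T h F A (alt_word true false m) p.
rewrite !map_alt_word /= in H H'; rewrite H H'.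
have := @fold_string_int R V T l T0 (F i) (F j) (A i) (A j) (FA i) (FA j) ij ji l0 ks _ _ E p.
have -> : (fun b => if b then F j else F i) = F \o h by apply/funext => -[].
have -> : (fun b => if b then A j else A i) = A \o h by apply/funext => -[].
by apply=> -[]; apply: pc.
Qed.

(** Equality of the transforms is uniform in the type, by chain infima; integrality of strings goes
    through the classification. The asymmetric types occur twice, according to which root is the
    long one. *)
Lemma braid_equiv_alt i j (a b m : nat) : (0 < m)%N ->
  F i (A j) = - a%:R -> F j (A i) = - b%:R ->
  (forall k, (k < m)%N -> 0 <= cheb a%:R b%:R k.+1 :> R) ->
  (forall k, (k < m)%N -> 0 <= cheb b%:R a%:R k.+1 :> R) ->
  cheb a%:R b%:R m = 0 :> R -> cheb b%:R a%:R m = 0 :> R ->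
  braid_equiv T F A (alt_word i j m) (alt_word j i m).
Proof.
move=> m0 ij ji ca cb c0 c0' p pc; split.
  exact: (pit_word_alt_eq FA ij ji ca cb c0 c0').
have := rank_two_cases m0 ca cb c0 c0'.
rewrite !inE => /or4P[||| /or3P[||]] /eqP[? ? ?]; subst a b m.
- have ij0 : F i (A j) = 0 by rewrite ij oppr0.
  have ji0 : F j (A i) = 0 by rewrite ji oppr0.
  by have [] := braid_equiv2 FA ij0 ji0 pc.
- by have [] := braid_equiv3 FA T0 ij ji pc.
- exact: (string_int_fold (ks := [:: 0; 1; 3; 2; 0; 2; 1]%N) _ ij ji).
- by apply: iff_sym; exact: (string_int_fold (ks := [:: 0; 1; 3; 2; 0; 2; 1]%N) _ ji ij).
- exact: (string_int_fold (ks := [:: 4; 5; 4; 2; 6; 4; 3; 1; 3; 6; 5; 7; 9; 8; 6;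
    4; 3; 2; 0; 6; 4; 2; 4; 8; 7; 5; 3; 5; 7; 6; 5]%N) _ ij ji).
- by apply: iff_sym; exact: (string_int_fold (ks := [:: 4; 5; 4; 2; 6; 4; 3; 1; 3;
    6; 5; 7; 9; 8; 6; 4; 3; 2; 0; 6; 4; 2; 4; 8; 7; 5; 3; 5; 7; 6; 5]%N) _ ji ij).
Qed.

End RankTwoBraid.

(** * Root systems and reduced words *)

Section Weyl.
Context {R : realType} {V : vectType R} (Phi : rootSystem V).
Implicit Types (i j : 'I_(rank Phi)) (u v w : seq 'I_(rank Phi)) (x y : V).

Local Notation al := (@simple _ _ Phi).
Local Notation s := (simple_refl (Phi := Phi)).
Local Notation W := (weyl_word (Phi := Phi)).
Local Notation co := (@simple_coroot _ _ Phi).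

Fact simple_refl_linear i : linear (s i).
Proof.
by move=> c x y; rewrite /simple_refl linearP /= scalerDl opprD addrACA scalerBr scalerA.
Qed.

HB.instance Definition _ i :=
  GRing.isLinear.Build R V V *:%R (s i) (simple_refl_linear i).

Fact weyl_word_linear u : linear (W u).
Proof. by elim: u => [|i u IH] c x y //=; rewrite IH linearP. Qed.

HB.instance Definition _ u :=
  GRing.isLinear.Build R V V *:%R (W u) (weyl_word_linear u).

Lemma weyl_wordBZ u x c y : W u (x - c *: y) = W u x - c *: W u y.
Proof. by rewrite linearB linearZ. Qed.

Lemma weyl_wordN u x : W u (- x) = - W u x.
Proof. exact: linearN. Qed.

Lemma weyl_word_cat u v x : W (u ++ v) x = W u (W v x).
Proof. by elim: u => //= i u ->. Qed.

Lemma weyl_word_rcons u i x : W (rcons u i) x = W u (s i x).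
Proof. by rewrite -cats1 weyl_word_cat. Qed.

Lemma co_simple i : co i (al i) = 2.
Proof. exact: coroot_self (simple_root _). Qed.

Lemma simple_refl_simple i : s i (al i) = - al i.
Proof. by rewrite /simple_refl co_simple scaler_nat mulr2n opprD addrA subrr sub0r. Qed.

Lemma simple_reflK i : involutive (s i).
Proof.
move=> x; rewrite [in X in s i X]/simple_refl linearB linearZ /= simple_refl_simple.
by rewrite scalerN opprK subrK.
Qed.

Lemma weyl_wordK u x : W (rev u) (W u x) = x.
Proof.
elim: u x => //= i u IH x.
by rewrite rev_cons weyl_word_rcons simple_reflK.
Qed.

Lemma weyl_wordKr u x : W u (W (rev u) x) = x.
Proof. by rewrite -{1}(revK u) weyl_wordK. Qed.

Lemma weyl_rev_eq u v : W u =1 W v -> W (rev u) =1 W (rev v).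
Proof. by move=> uv x; rewrite -{1}(weyl_wordKr v x) -uv weyl_wordK. Qed.

Lemma weyl_root u b : b \in Defs.roots Phi -> W u b \in Defs.roots Phi.
Proof. by move=> br; elim: u => //= i u IH; apply: roots_refl => //; exact: simple_root. Qed.

Lemma root_opp b : b \in Defs.roots Phi -> - b \in Defs.roots Phi.
Proof.
move=> br; have := roots_refl br br.
by rewrite coroot_self // scaler_nat mulr2n opprD addrA subrr sub0r.
Qed.

Lemma root_neq0 b : b \in Defs.roots Phi -> b != 0.
Proof. by move=> br; apply: contraNneq (roots_neq0 Phi) => <-. Qed.

Definition simple_tuple := [tuple al i | i < rank Phi].

Lemma simple_tuple_basis : basis_of fullv simple_tuple.
Proof.
by have := simple_basis Phi; congr (is_true (basis_of _ _)).
Qed.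

Definition scoord i : {scalar V} := coord simple_tuple i.

Lemma scoord_simple i j : scoord i (al j) = (i == j)%:R.
Proof.
have fr : free simple_tuple := basis_free simple_tuple_basis.
by have := coord_free j i fr; rewrite -tnth_nth tnth_mktuple eq_sym.
Qed.

Lemma scoordE x : x = \sum_i scoord i x *: al i.
Proof.
rewrite {1}(coord_basis simple_tuple_basis (memvf x)); apply: eq_bigr => i _.
by rewrite -tnth_nth tnth_mktuple.
Qed.

Lemma scoord_sum (c : 'I_(rank Phi) -> R) j : scoord j (\sum_i c i *: al i) = c j.
Proof.
rewrite linear_sum (bigD1 j) //= linearZ /= scoord_simple eqxx mulr1 big1 ?addr0 //.
by move=> i ij; rewrite linearZ /= scoord_simple eq_sym (negbTE ij) mulr0.
Qed.

Definition pos x := forall i, 0 <= scoord i x.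

Lemma pos_simple i : pos (al i).
Proof. by move=> j; rewrite scoord_simple ler0n. Qed.

Lemma pos_add x y : pos x -> pos y -> pos (x + y).
Proof. by move=> px py i; rewrite linearD addr_ge0 ?px ?py. Qed.

Lemma pos_scale c x : 0 <= c -> pos x -> pos (c *: x).
Proof. by move=> c0 px i; rewrite linearZ mulr_ge0 ?px. Qed.

Lemma pos0 : pos 0.
Proof. by move=> i; rewrite linear0 lexx. Qed.

Lemma pos_anti x : pos x -> pos (- x) -> x = 0.
Proof.
move=> px nx; rewrite (scoordE x) big1 // => i _.
suff -> : scoord i x = 0 by rewrite scale0r.
by have := px i; have := nx i; rewrite linearN; lra.
Qed.

Lemma root_pos b : b \in Defs.roots Phi -> pos b \/ pos (- b).
Proof.
move=> /simple_coef[c [->|->]]; [left|right] => i; rewrite ?opprK scoord_sum ler0n //.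
Qed.

Lemma root_scoord_int b i : b \in Defs.roots Phi -> scoord i b \is a Num.int.
Proof.
by move=> /simple_coef[c [->|->]]; rewrite ?linearN /= scoord_sum ?rpredN rpred_nat.
Qed.

Lemma root_pos_opp b : b \in Defs.roots Phi -> pos b -> ~ pos (- b).
Proof. by move=> br pb nb; move: (root_neq0 br); rewrite (pos_anti pb nb) eqxx. Qed.

(* The product of two reflections along [a] preserving the finite set of roots
   is a unipotent of finite order, hence trivial. *)
Lemma coroot_unique a (f : {scalar V}) : a \in Defs.roots Phi -> f a = 2 ->
  (forall b, b \in Defs.roots Phi -> b - f b *: a \in Defs.roots Phi) ->
  forall x, f x = coroot Phi a x.
Proof.
move=> ar fa fr.
have onroots b : b \in Defs.roots Phi -> f b = coroot Phi a b.
  move=> br; apply/eqP; apply: contraT => ne.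
  have nd : coroot Phi a b - f b != 0 by rewrite subr_eq0 eq_sym.
  (* The orbit of [b] under the product of the two reflections: an arithmetic progression along [a],
     all of whose terms are roots. *)
  pose r n := b + (n%:R * (coroot Phi a b - f b)) *: a.
  have rr n : r n \in Defs.roots Phi.
    elim: n => [|n IH]; first by rewrite /r mul0r scale0r addr0.
    have := fr _ (roots_refl ar IH).
    have ca : coroot Phi a (r n) =
        coroot Phi a b + 2 * (n%:R * (coroot Phi a b - f b)).
      by rewrite /r linearD linearZ /= coroot_self //; ring.
    have cf : f (r n) = f b + 2 * (n%:R * (coroot Phi a b - f b)).
      by rewrite /r linearD linearZ /= fa; ring.
    suff -> : r n.+1 = (r n - coroot Phi a (r n) *: a) -
                f (r n - coroot Phi a (r n) *: a) *: a by [].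
    rewrite scalarBZ fa ca cf /r -!addrA -!scaleNr -!scalerDl; congr (_ + _ *: _).
    rewrite -[_ *: 2]/(_ * 2) -[n.+1]addn1 natrD; ring.
  have u : uniq [seq r n | n <- iota 0 (size (Defs.roots Phi)).+1].
    rewrite map_inj_uniq ?iota_uniq // => m n /addrI /eqP.
    rewrite -subr_eq0 -scalerBl scaler_eq0 (negbTE (root_neq0 ar)) orbF -mulrBl.
    by rewrite mulf_eq0 (negbTE nd) orbF subr_eq0 eqr_nat => /eqP.
  have : {subset [seq r n | n <- iota 0 (size (Defs.roots Phi)).+1] <= Defs.roots Phi}.
    by move=> _ /mapP[n _ ->].
  by move/(uniq_leq_size u); rewrite size_map size_iota ltnn.
move=> x; have xs : x \in <<in_tuple (Defs.roots Phi)>>%VS by rewrite roots_span memvf.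
rewrite (coord_span xs) !linear_sum; apply: eq_bigr => i _.
by rewrite !linearZ /= onroots // mem_nth.
Qed.

(** Transporting the coroot of [b] by [W u] gives a functional with value 2 on [W u b] whose
    reflection preserves the roots; [coroot_unique] identifies it. *)
Lemma coroot_weyl u b x : b \in Defs.roots Phi -> coroot Phi (W u b) (W u x) = coroot Phi b x.
Proof.
move=> br; have ur : W u b \in Defs.roots Phi by exact: weyl_root.
pose f : {scalar V} := (coroot Phi b \o W (rev u)).
rewrite -(coroot_unique (f := f) ur) /f /= ?weyl_wordK ?coroot_self // => c cr /=.
have -> : c - coroot Phi b (W (rev u) c) *: W u b =
    W u (W (rev u) c - coroot Phi b (W (rev u) c) *: b).
  by rewrite weyl_wordBZ weyl_wordKr.
by apply: weyl_root; apply: roots_refl => //; exact: weyl_root.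
Qed.

(** Roots have integral simple coordinates; for [W u] and its inverse this makes [c] and [c^-1]
    positive integers. The argument also covers root systems containing multiples of a root. *)
Lemma weyl_simple_multiple u i j c : 0 <= c -> W u (al i) = c *: al j -> W u (al i) = al j.
Proof.
move=> c0 E; suff c1 : c = 1 by rewrite E c1 scale1r.
have cn0 : c != 0.
  apply: contraTneq (root_neq0 (weyl_root u (simple_root i))) => cz.
  by rewrite E cz scale0r eqxx.
have ci : c \is a Num.int.
  have := root_scoord_int j (weyl_root u (simple_root i)).
  by rewrite E linearZ /= scoord_simple eqxx mulr1.
have E' : W (rev u) (al j) = c^-1 *: al i.
  by rewrite -(weyl_wordK u (al i)) E linearZ /= scalerA mulVf // scale1r.
have di : c^-1 \is a Num.int.
  have := root_scoord_int i (weyl_root (rev u) (simple_root j)).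
  by rewrite E' linearZ /= scoord_simple eqxx mulr1.
have cgt : 0 < c by rewrite lt_def cn0.
have ge1 (z : R) : 0 < z -> z \is a Num.int -> 1 <= z.
  by move=> z0 /intrP[m mE]; move: z0; rewrite mE ltr0z ler1z gtz0_ge1.
have h1 := ge1 _ cgt ci.
have h2 : 1 <= c^-1 by apply: ge1; rewrite ?invr_gt0.
have : c * c^-1 = 1 by rewrite divff.
nra.
Qed.

(** [s j] changes only the coordinate [j], so the other coordinates of [b] are both non-negative and
    non-positive. *)
Lemma simple_refl_pos j b : b \in Defs.roots Phi -> pos b -> ~ pos (s j b) ->
  b = scoord j b *: al j.
Proof.
move=> br pb np.
have sr : s j b \in Defs.roots Phi := weyl_root [:: j] br.
have [//|ns] := root_pos sr.
rewrite {1}(scoordE b) (bigD1 j) //= big1 ?addr0 // => i ij.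
suff -> : scoord i b = 0 by rewrite scale0r.
have := ns i; have := pb i; rewrite linearN linearB linearZ /=.
by rewrite scoord_simple (negbTE ij) mulr0 subr0; lra.
Qed.

(** Some letter [j] of [u] sends the positive root [W u2 (al i)] to a negative one. By the two
    preceding lemmas that root is [al j], so [s j] composed with [W u2] is [W u2] composed with
    [s i], and [j] can be deleted. *)
Lemma exchange u i : ~ pos (W u (al i)) ->
  exists u1 j u2, u = u1 ++ j :: u2 /\ W (u1 ++ u2) =1 W (rcons u i).
Proof.
elim: u => [|j u IH] /= np; first by case: np; exact: pos_simple.
have [pu|/IH[u1 [k [u2 [-> E]]]]] := pselect (pos (W u (al i))); last first.
  by exists (j :: u1), k, u2; split=> // x /=; rewrite E.
exists [::], j, u; split=> // x /=.
have ur := weyl_root u (simple_root i).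
have E := weyl_simple_multiple (pu j) (simple_refl_pos ur pu np).
have co_u : simple_coroot j (W u x) = co i x.
  by rewrite -(coroot_weyl u x (simple_root i)) E.
have -> : W (rcons u i) x = s j (W u x).
  by rewrite weyl_word_rcons /simple_refl weyl_wordBZ E co_u.
by rewrite simple_reflK.
Qed.


End Weyl.

(** * Reduced words and Matsumoto's theorem *)

Section Reduced.
Context {R : realType} {V : vectType R} (Phi : rootSystem V).
Implicit Types (i j : 'I_(rank Phi)) (u v w x y : seq 'I_(rank Phi)).

Local Notation al := (@simple _ _ Phi).
Local Notation s := (simple_refl (Phi := Phi)).
Local Notation W := (weyl_word (Phi := Phi)).
Local Notation co := (@simple_coroot _ _ Phi).
Local Notation pos := (pos Phi).

Definition reduced u := forall v, W u =1 W v -> (size u <= size v)%N.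

Lemma reduced_decompositionP (w0 : V -> V) u :
  reduced_decomposition w0 u <-> w0 = W u /\ reduced u.
Proof.
split=> -[-> ru]; split=> // v uv; apply: ru; first exact/funext.
by rewrite uv.
Qed.

Lemma weyl_cat_eq u u' v v' : W u =1 W u' -> W v =1 W v' -> W (u ++ v) =1 W (u' ++ v').
Proof. by move=> uu vv t; rewrite !weyl_word_cat vv uu. Qed.

Lemma weyl_cat_injl u v v' : W (u ++ v) =1 W (u ++ v') -> W v =1 W v'.
Proof.
by move=> E t; have := congr1 (W (rev u)) (E t); rewrite !weyl_word_cat !weyl_wordK.
Qed.

Lemma weyl_cat_injr u u' v : W (u ++ v) =1 W (u' ++ v) -> W u =1 W u'.
Proof.
by move=> E t; have := E (W (rev v) t); rewrite !weyl_word_cat !weyl_wordKr.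
Qed.

Lemma reduced_eq_size u v : W u =1 W v -> reduced u -> size v = size u -> reduced v.
Proof. by move=> uv ru sv w vw; rewrite sv; apply: ru => t; rewrite uv. Qed.

Lemma reduced_size u v : W u =1 W v -> reduced u -> reduced v -> size u = size v.
Proof. by move=> uv ru rv; apply/eqP; rewrite eqn_leq ru ?rv // => t; rewrite uv. Qed.

Lemma reduced_catl u v : reduced (u ++ v) -> reduced u.
Proof.
move=> r w uw; have := r (w ++ v); rewrite !size_cat leq_add2r; apply.
exact: weyl_cat_eq.
Qed.

Lemma reduced_catr u v : reduced (u ++ v) -> reduced v.
Proof.
move=> r w vw; have := r (u ++ w); rewrite !size_cat leq_add2l; apply.
exact: weyl_cat_eq.
Qed.

Lemma reduced_rev u : reduced u -> reduced (rev u).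
Proof.
move=> r w uw; rewrite size_rev -(size_rev w); apply: r.
by rewrite -{1}(revK u); exact: weyl_rev_eq.
Qed.

Lemma reduced_exists u : exists2 v, reduced v & W u =1 W v.
Proof.
pose P n := `[< exists v, size v = n /\ W u =1 W v >].
have exP : exists n, P n by exists (size u); apply/asboolP; exists u.
case: (ex_minnP exP) => n /asboolP[v [<- uv]] mn; exists v => // w vw.
by apply: mn; apply/asboolP; exists w; split => // t; rewrite uv.
Qed.

Lemma reduced_rcons_pos u i : reduced (rcons u i) -> pos (W u (al i)).
Proof.
move=> r; apply: contrapT => /exchange[u1 [j [u2 [uE E]]]].
have := r (u1 ++ u2) (fun t => esym (E t)).
by rewrite size_rcons uE !size_cat /=; lia.
Qed.

Lemma pos_reduced_rcons u i : reduced u -> pos (W u (al i)) -> reduced (rcons u i).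
Proof.
move=> r p v E; have : ~ pos (W v (al i)).
  rewrite -E weyl_word_rcons simple_refl_simple linearN.
  by apply: root_pos_opp p; apply: weyl_root; exact: simple_root.
move=> /exchange[v1 [j [v2 [vE vE']]]].
have /r : W u =1 W (v1 ++ v2).
  by move=> t; rewrite vE' weyl_word_rcons -E weyl_word_rcons simple_reflK.
by rewrite size_rcons vE !size_cat /=; lia.
Qed.

Lemma exchange_left u i : ~ pos (W (rev u) (al i)) ->
  exists u1 j u2, u = u1 ++ j :: u2 /\ W (u1 ++ u2) =1 W (i :: u).
Proof.
move=> /exchange[u1 [j [u2 [uE E]]]]; exists (rev u2), j, (rev u1); split.
  by rewrite -(revK u) uE rev_cat rev_cons cat_rcons.
by move=> t; rewrite -rev_cat (weyl_rev_eq E) rev_rcons revK.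
Qed.

Lemma left_descent i u v : reduced (i :: u) -> W (i :: u) =1 W v ->
  ~ pos (W (rev v) (al i)).
Proof.
move=> r E; have := reduced_rev r; rewrite rev_cons => /reduced_rcons_pos p.
rewrite -(weyl_rev_eq E) rev_cons weyl_word_rcons simple_refl_simple linearN.
by apply: root_pos_opp p; apply: weyl_root; exact: simple_root.
Qed.

Lemma reduced_alternate i j u : (forall k, k \in u -> k = i \/ k = j) ->
  reduced (i :: u) -> i :: u = alt_word i j (size u).+1.
Proof.
elim: u i j => [|k u IH] i j ij r //.
have kj : k = j.
  have [ki|//] := ij k (mem_head _ _); subst k.
  have := r u (fun t => simple_reflK i (W u t)); rewrite /=; lia.
subst k; congr (i :: _); apply: IH; last exact: (reduced_catr (u := [:: i])).
by move=> k ku; have [->|->] := ij k (mem_behead (s := j :: u) ku); [right|left].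
Qed.

Section Matsumoto.
Variable equiv : seq 'I_(rank Phi) -> seq 'I_(rank Phi) -> Prop.
Hypothesis equiv_refl : forall u, equiv u u.
Hypothesis equiv_sym : forall u v, equiv u v -> equiv v u.
Hypothesis equiv_trans : forall v u w, equiv u v -> equiv v w -> equiv u w.
Hypothesis equiv_cat : forall x u v y, equiv u v -> equiv (x ++ u ++ y) (x ++ v ++ y).
Hypothesis equiv_alt : forall i j m, (0 < m)%N -> i != j -> reduced (alt_word i j m) ->
  W (alt_word i j m) =1 W (alt_word j i m) -> equiv (alt_word i j m) (alt_word j i m).

Let same_head n := forall i u v, size u = n ->
  reduced (i :: u) -> reduced (i :: v) -> W (i :: u) =1 W (i :: v) -> equiv (i :: u) (i :: v).

(** As [j] is a left descent, exchange moves it to the front at the price of one letter. If that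
    letter lies in [x], the alternating prefix grows by one. If it lies in the prefix, what precedes
    [x] becomes a reduced word in [i] and [j], so the two alternating words of length [k] agree in
    the Weyl group; a braid relation and [same_head] conclude. *)
Let extend_alt n i j k x v : same_head n -> i != j -> (0 < k)%N ->
  size v = n -> reduced (j :: v) ->
  reduced (alt_word i j k ++ x) -> W (alt_word i j k ++ x) =1 W (j :: v) ->
  equiv (alt_word i j k ++ x) (j :: v) \/
  exists y, [/\ reduced (alt_word j i k.+1 ++ y) & W (alt_word j i k.+1 ++ y) =1 W (j :: v)].
Proof.
move=> sh ij k0 sv rv ru E.
have sz := reduced_size E ru rv.
have [p1 [c [p2 [pE pW]]]] := exchange_left (left_descent rv (fun t => esym (E t))).
have jW : W (j :: p1 ++ p2) =1 W (j :: v).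
  by move=> t; rewrite -[LHS]/(s j (W (p1 ++ p2) t)) pW /= simple_reflK E.
have jr : reduced (j :: p1 ++ p2).
  apply: (reduced_eq_size (u := j :: v)) => //.
  move: sz; rewrite pE /= !size_cat /=; lia.
have [kp|pk] := leqP k (size p1).
  right; exists (drop k p1 ++ p2).
  have p1E : alt_word i j k = take k p1.
    have := congr1 (take k) pE; rewrite take_size_cat ?size_alt_word // takel_cat //.
  rewrite /= -/(alt_word i j k) p1E catA cat_take_drop.
  by split.
left.
have altE : alt_word i j k = p1 ++ c :: take (k - (size p1).+1) p2.
  have := congr1 (take k) pE; rewrite take_size_cat ?size_alt_word // take_cat ltnNge ltnW //=.
  have -> : (k - size p1 = (k - (size p1).+1).+1)%N by lia.
  by [].
have p2E : p2 = take (k - (size p1).+1) p2 ++ x.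
  move: pE; rewrite altE -catA => /eqP; rewrite eqseq_cat // => /andP[_ /eqP[{1}<-]].
  by [].
set p2' := take _ _ in altE p2E.
have dW : W (j :: p1 ++ p2') =1 W (alt_word i j k).
  apply: (weyl_cat_injr (v := x)) => t.
  by rewrite cat_cons -catA -p2E jW E.
have dr : reduced (j :: p1 ++ p2').
  by apply: (reduced_catl (v := x)); rewrite cat_cons -catA -p2E.
have dE : j :: p1 ++ p2' = alt_word j i k.
  have sE : k = (size (p1 ++ p2')).+1.
    by rewrite -(size_alt_word i j k) altE !size_cat /= addnS.
  rewrite {1}sE; apply: reduced_alternate => // l lp.
  have : l \in alt_word i j k.
    by rewrite altE mem_cat inE; move: lp; rewrite mem_cat => /orP[->|->]; rewrite ?orbT.
  by clear; elim: k i j => //= k IH i j; rewrite inE => /orP[/eqP->|/IH[]->]; tauto.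
rewrite dE in dW dr.
have ar : reduced (alt_word i j k) := reduced_catl ru.
have ae : equiv (alt_word i j k) (alt_word j i k).
  by apply: equiv_alt => // t; rewrite dW.
have ae' := equiv_cat [::] x ae; rewrite !cat0s in ae'.
apply: (equiv_trans ae').
have WE : W (alt_word j i k ++ x) =1 W (j :: v).
  by move=> t; rewrite -E; apply: weyl_cat_eq.
have sE : size (alt_word j i k ++ x) = size (j :: v).
  by rewrite -sz !size_cat !size_alt_word.
have r2 : reduced (alt_word j i k ++ x).
  by apply: (reduced_eq_size (u := j :: v)) => // t; rewrite WE.
rewrite -(prednK k0) /= in WE sE r2 *; case: sE => sE.
by apply: sh => //; rewrite sE.
Qed.

(** Induction on the length settles equal first letters. For distinct ones, [extend_alt] is applied
    to both sides in parallel, giving ever longer alternating prefixes until equivalence is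
    reached. *)
Theorem matsumoto u v : reduced u -> reduced v -> W u =1 W v -> equiv u v.
Proof.
have [n] := ubnP (size u); elim: n u v => // n IH u v /ltnSE su ru rv E.
have sz := reduced_size E ru rv.
have sh m : (m < n)%N -> same_head m.
  move=> mn i u' v' su' ru' rv' E'.
  have := @equiv_cat [:: i] u' v' [::]; rewrite !cats0; apply; apply: IH.
  - by rewrite su'.
  - exact: (reduced_catr (u := [:: i])).
  - exact: (reduced_catr (u := [:: i])).
  - exact: (weyl_cat_injl (u := [:: i])).
case: u v su ru rv E sz => [|i u] [|j v] //= su ru rv E [sz].
have [ij|ij] := eqVneq i j; first by subst j; apply: (sh (size u)).
have shu := sh _ su; have shv : same_head (size v) by rewrite -sz.
have C k : (0 < k)%N -> equiv (i :: u) (j :: v) \/ exists x y,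
    [/\ reduced (alt_word i j k ++ x), W (alt_word i j k ++ x) =1 W (i :: u),
        reduced (alt_word j i k ++ y) & W (alt_word j i k ++ y) =1 W (j :: v)].
  elim: k => // -[|k] IHk _; first by right; exists u, v.
  have [h|[x [y [rx Ex ry Ey]]]] := IHk isT; first by left.
  have head a b z : alt_word a b k.+1 ++ z = a :: (alt_word b a k ++ z) by [].
  have ex : equiv (i :: u) (alt_word i j k.+1 ++ x).
    by rewrite head in rx Ex *; apply: shu => // t; rewrite Ex.
  have ey : equiv (j :: v) (alt_word j i k.+1 ++ y).
    by rewrite head in ry Ey *; apply: shv => // t; rewrite Ey.
  have Exv : W (alt_word i j k.+1 ++ x) =1 W (j :: v) by move=> t; rewrite Ex; exact: E.
  have Eyu : W (alt_word j i k.+1 ++ y) =1 W (i :: u) by move=> t; rewrite Ey; exact: esym (E t).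
  have [h|[y' [ry' Ey']]] := extend_alt shv ij (ltn0Sn k) erefl rv rx Exv.
    by left; exact: equiv_trans ex h.
  rewrite eq_sym in ij.
  have [h|[x' [rx' Ex']]] := extend_alt shu ij (ltn0Sn k) erefl ru ry Eyu.
    by left; apply: equiv_sym; exact: equiv_trans ey h.
  by right; exists x', y'.
(* A prefix of this length is longer than the reduced word [i :: u]. *)
have [//|[x [y [rx Ex _ _]]]] := C (size u).+2 isT.
have := reduced_size Ex rx ru; rewrite size_cat size_alt_word /=; lia.
Qed.

End Matsumoto.

End Reduced.

(** * Dihedral subsystems and the longest element *)

Section WeylPitman.
Context {R : realType} {V : vectType R} (Phi : rootSystem V).
Implicit Types (i j : 'I_(rank Phi)) (u v w : seq 'I_(rank Phi)) (x y : V).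

Local Notation al := (@simple _ _ Phi).
Local Notation s := (simple_refl (Phi := Phi)).
Local Notation W := (weyl_word (Phi := Phi)).
Local Notation co := (@simple_coroot _ _ Phi).
Local Notation pos := (pos Phi).

(** The root [s i (al j)] has coordinate 1 at [j], hence is positive, and its coordinate at [i] is
    the opposite of the Cartan entry. *)
Lemma cartan_nat i j : i != j -> exists a : nat, co i (al j) = - a%:R.
Proof.
move=> ij; have sr : s i (al j) \in Defs.roots Phi := weyl_root [:: i] (simple_root j).
have ci : scoord i (s i (al j)) = - co i (al j).
  by rewrite /simple_refl scalarBZ !scoord_simple eqxx (negbTE ij) mulr1 sub0r.
have cj : scoord j (s i (al j)) = 1.
  by rewrite /simple_refl scalarBZ !scoord_simple eqxx eq_sym (negbTE ij) mulr0 subr0.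
have [p|n] := root_pos sr; last first.
  by have := n j; rewrite linearN cj; lra.
have c0 : 0 <= - co i (al j) by rewrite -ci; exact: p.
have : - co i (al j) \is a Num.int by rewrite -ci root_scoord_int.
move=> /intrP[[m|m] mE].
  by exists m; rewrite -pmulrn in mE; rewrite -mE opprK.
by move: c0; rewrite mE NegzE ler0z.
Qed.

(** Links [cheb] to the geometry: positivity of these roots along reduced words, and their change of
    sign at the braid relation, supply the sign conditions needed for chain infima. *)
Lemma alt_root i j (a b : R) k : co i (al j) = - a -> co j (al i) = - b ->
  W (rev (alt_word i j k)) (al j) =
  cheb a b k.+1 *: al (if odd k then i else j) + cheb a b k *: al (if odd k then j else i).
Proof.
move=> ij ji; elim: k => [|k IH]; first by rewrite /cheb /= scale1r scale0r addr0.
rewrite alt_wordSr rev_rcons -[LHS]/(s _ (W (rev (alt_word i j k)) (al j))) IH.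
rewrite linearD !linearZ /= chebSS.
have aji c : c *: s i (al j) = c *: al j + (c * a) *: al i.
  by rewrite /simple_refl ij scaleNr opprK scalerDr scalerA.
have aij c : c *: s j (al i) = c *: al i + (c * b) *: al j.
  by rewrite /simple_refl ji scaleNr opprK scalerDr scalerA.
by case: (odd k) => /=; rewrite ?aij ?aji simple_refl_simple scalerN scalerBl
  -addrA [LHS]addrC [_ * cheb _ _ _]mulrC.
Qed.

Lemma alt_cheb_ge0 i j (a b : R) m : co i (al j) = - a -> co j (al i) = - b -> i != j ->
  reduced (alt_word i j m) -> W (alt_word i j m) =1 W (alt_word j i m) ->
  forall k, (k < m)%N -> 0 <= cheb a b k.+1.
Proof.
move=> ij ji neq r E k km.
have r' : reduced (alt_word j i m).
  by apply: reduced_eq_size E r _; rewrite !size_alt_word.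
have pre_alt c d n n' : (n <= n')%N ->
    exists z : seq 'I_(rank Phi), alt_word c d n' = alt_word c d n ++ z.
  elim: n n' c d => [|n IH] [|n'] c d //; try by eexists.
  by rewrite ltnS => /(IH _ d c)[z zE]; exists z; rewrite /= zE.
have [z zE] := pre_alt j i k.+1 m km.
have : reduced (rev (alt_word j i k.+1)).
  by apply: reduced_rev; apply: (reduced_catl (v := z)); rewrite -zE.
rewrite /= rev_cons => /reduced_rcons_pos/(_ (if odd k then i else j)).
rewrite (alt_root k ij ji) linearD !linearZ /= !scoord_simple eqxx mulr1.
suff -> : ((if odd k then i else j) == (if odd k then j else i)) = false by rewrite mulr0 addr0.
by case: odd; [exact: negbTE | rewrite eq_sym; exact: negbTE].
Qed.

Lemma alt_cheb_eq0 i j (a b : R) m : co i (al j) = - a -> co j (al i) = - b -> i != j ->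
  (0 < m)%N -> W (alt_word i j m) =1 W (alt_word j i m) -> cheb a b m = 0.
Proof.
move=> ij ji neq m0 E; have := weyl_rev_eq E (al j).
rewrite -(prednK m0) [in RHS]/= rev_cons weyl_word_rcons simple_refl_simple weyl_wordN.
rewrite (alt_root _ ij ji) (alt_root _ ij ji) /=; set k := m.-1.
(* At this coordinate the two sides carry [cheb a b m] with opposite signs. *)
move=> /(congr1 (scoord (if odd k then i else j))).
have scN (f : {scalar V}) x : f (- x) = - f x by exact: linearN.
have scD (f : {scalar V}) c x d y : f (c *: x + d *: y) = c * f x + d * f y.
  by rewrite linearD !linearZ.
rewrite scN !scD !scoord_simple.
have ji' : (j == i) = false by rewrite eq_sym; exact: negbTE.
by case: (odd k); rewrite /= ?eqxx ?(negbTE neq) ?ji' /=; lra.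
Qed.

Theorem reduced_braid_equiv (T : R) u v : 0 <= T -> reduced u -> reduced v ->
  W u =1 W v -> braid_equiv T co al u v.
Proof.
move=> T0; apply: matsumoto => [w|x y|w x y|x x' y y'|i j m m0 ij r E].
- exact: braid_equiv_refl.
- exact: braid_equiv_sym.
- exact: braid_equiv_trans.
- exact: braid_equiv_cat.
have [a aE] := cartan_nat ij; have [b bE] : exists b : nat, co j (al i) = - b%:R.
  by apply: cartan_nat; rewrite eq_sym.
have ji : j != i by rewrite eq_sym.
have E' t : W (alt_word j i m) t = W (alt_word i j m) t by rewrite E.
have r' : reduced (alt_word j i m).
  by apply: reduced_eq_size E r _; rewrite !size_alt_word.
apply: (braid_equiv_alt (@co_simple _ _ Phi) T0 m0 aE bE).
- exact: alt_cheb_ge0 aE bE ij r E.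
- exact: alt_cheb_ge0 bE aE ji r' E'.
- exact: alt_cheb_eq0 aE bE ij m0 E.
- exact: alt_cheb_eq0 bE aE ji m0 E'.
Qed.

Lemma weight_lattice_weyl u x : weight_lattice Phi x -> weight_lattice Phi (W u x).
Proof.
move=> xP; elim: u => //= i u IH j.
rewrite /= /simple_refl scalarBZ; apply: rpredB; first exact: IH.
by apply: rpredM; [exact: IH | apply: coroot_int; exact: simple_root].
Qed.

Section Longest.
Variables (w0 : V -> V) (ws : seq 'I_(rank Phi)).
Hypotheses (w0L : longest_element Phi w0) (w0E : reduced_decomposition w0 ws).

Lemma longest_size v : reduced v -> (size v <= size ws)%N.
Proof.
move=> rv; have [_ /(_ ws (W v) v w0E)] := w0L; apply; first by exists v.
exact/reduced_decompositionP.
Qed.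

Lemma longest_reduced : reduced ws.
Proof. by have /reduced_decompositionP[] := w0E. Qed.

Lemma longest_neg i : ~ pos (W ws (al i)).
Proof.
move=> /(pos_reduced_rcons longest_reduced)/longest_size.
by rewrite size_rcons ltnn.
Qed.

Lemma longest_rev_neg i : ~ pos (W (rev ws) (al i)).
Proof.
move=> /(pos_reduced_rcons (reduced_rev longest_reduced))/reduced_rev/longest_size.
by rewrite size_rev size_rcons size_rev ltnn.
Qed.

Lemma longest_pos x : pos x -> pos (- W ws x).
Proof.
move=> px j; rewrite (scoordE Phi x) linear_sum -sumrN linear_sum sumr_ge0 // => i _.
rewrite linearZ /= -scalerN linearZ /= mulr_ge0 ?px //.
have [/longest_neg//|] := root_pos (weyl_root ws (simple_root i)); exact.
Qed.

(** The square of the longest element keeps positive roots positive, whereas a non-empty reduced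
    word makes the simple root of its last letter negative. *)
Lemma longest_inv : involutive (W ws).
Proof.
move=> x; rewrite -weyl_word_cat.
have [v rv vE] := reduced_exists (ws ++ ws); rewrite vE.
case/lastP: v rv vE => // v i rv vE.
have := vE (al i); rewrite weyl_word_cat weyl_word_rcons simple_refl_simple weyl_wordN => E.
have := longest_pos (longest_pos (pos_simple i)).
rewrite weyl_wordN opprK E => np.
have := root_pos_opp (weyl_root v (simple_root i)) (reduced_rcons_pos rv).
by [].
Qed.

(** The opposite of the longest element is an involution with non-negative matrix in the simple
    basis. A non-negative matrix with non-negative inverse is monomial, and [weyl_simple_multiple]
    turns its entry into 1. *)
Lemma longest_star i : exists j, - W ws (al i) = al j.
Proof.
pose be k := - W ws (al k).
have bp k : pos (be k) by apply: longest_pos; exact: pos_simple.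
have br k : be k \in Defs.roots Phi by apply: root_opp; apply: weyl_root; exact: simple_root.
have alE k : al k = \sum_j scoord j (be k) *: be j.
  rewrite -{1}[al k]longest_inv -[LHS]opprK -weyl_wordN -/(be k) {1}(scoordE Phi (be k)).
  by rewrite linear_sum -sumrN; apply: eq_bigr => j _; rewrite linearZ /= -scalerN.
have [j jn0] : exists j, scoord j (be i) != 0.
  apply: contrapT => nj; move: (root_neq0 (br i)).
  rewrite (scoordE Phi (be i)) big1 ?eqxx // => j _.
  have [->|jn] := eqVneq (scoord j (be i)) 0; first by rewrite scale0r.
  by case: nj; exists j.
have bj : be j = scoord i (be j) *: al i.
  rewrite {1}(scoordE Phi (be j)) (bigD1 i) //= big1 ?addr0 // => k ki.
  have := congr1 (scoord k) (alE i).
  rewrite scoord_simple (negbTE ki) linear_sum /= => /esym/eqP.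
  rewrite psumr_eq0; last first.
    by move=> l _; rewrite linearZ /= mulr_ge0 ?bp.
  move=> /allP/(_ j (mem_index_enum _)); rewrite /= linearZ /= mulf_eq0 (negbTE jn0) /=.
  by move=> /eqP->; rewrite scale0r.
set c := scoord i (be j) in bj.
have jE : al j = c *: be i.
  by rewrite -{1}[al j]longest_inv -[LHS]opprK -weyl_wordN -/(be j) bj linearZ /= -scalerN.
have c0 : c != 0.
  by apply: contraTneq (root_neq0 (simple_root j)) => cz; rewrite jE cz scale0r eqxx.
(* Appending [s i] absorbs the minus sign, so that the vector is an image under the Weyl group
   itself. *)
exists j; have E : W (rcons ws i) (al i) = c^-1 *: al j.
  by rewrite weyl_word_rcons simple_refl_simple weyl_wordN jE scalerA mulVf ?scale1r.
have := weyl_simple_multiple _ E; rewrite weyl_word_rcons simple_refl_simple weyl_wordN.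
by apply; rewrite invr_ge0; exact: bp.
Qed.

Lemma coroot_star i j x : - W ws (al i) = al j -> co j (- W ws x) = co i x.
Proof.
move=> ij; have E : W (rcons ws i) (al i) = al j.
  by rewrite weyl_word_rcons simple_refl_simple weyl_wordN.
rewrite -[x in LHS](simple_reflK i) -weyl_word_rcons linearN /simple_coroot -E.
rewrite (coroot_weyl _ _ (simple_root i)) -/(co i _) /simple_refl scalarBZ co_simple.
ring.
Qed.

(** Every simple root becomes negative, so exchange deletes a letter of [ws], and appending [i]
    restores both the element and the length. *)
Lemma longest_rcons i : exists v, reduced (rcons v i) /\ W (rcons v i) =1 W ws.
Proof.
have [u1 [j [u2 [wE E]]]] := exchange (@longest_neg i).
have E' : W (rcons (u1 ++ u2) i) =1 W ws.
  by move=> t; rewrite weyl_word_rcons E weyl_word_rcons simple_reflK.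
exists (u1 ++ u2); split=> //.
apply: reduced_eq_size (fun t => esym (E' t)) longest_reduced _.
by rewrite size_rcons wE !size_cat /= addnS.
Qed.

Lemma longest_cons i : exists v, reduced (i :: v) /\ W (i :: v) =1 W ws.
Proof.
have [u1 [j [u2 [wE E]]]] := exchange_left (@longest_rev_neg i).
have E' : W (i :: u1 ++ u2) =1 W ws.
  by move=> t; rewrite -[LHS]/(s i (W (u1 ++ u2) t)) E /= simple_reflK.
exists (u1 ++ u2); split=> //.
apply: reduced_eq_size (fun t => esym (E' t)) longest_reduced _.
by rewrite wE /= !size_cat /= addnS.
Qed.

End Longest.

End WeylPitman.

(** * Path operations *)

Section PathOperators.
Context {R : realType} {V : vectType R}.
Implicit Types (T : R) (f : {scalar V}) (p q : R -> V).

Lemma cont_sum T (I : finType) (g : I -> R -> R) (c : I -> R) :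
  (forall i, cont T (g i)) -> cont T (fun t => \sum_i c i * g i t).
Proof.
move=> gc.
suff H (r : seq I) : cont T (fun t => \sum_(i <- r) c i * g i t) by exact: H.
elim: r => [|i r IH].
  apply: (@cont_eq _ _ (fun=> 0)) => [t _|x xT e e0]; first by rewrite big_nil.
  by exists 1 => // y _ _; rewrite subrr normr0.
apply: (@cont_eq _ _ (fun t => \sum_(i <- r) c i * g i t + c i * g i t)) => [t _|].
  by rewrite big_cons addrC.
exact: cont_comb.
Qed.

(** Continuity is tested on functionals: each is a combination of the coordinates in the basis, and
    each coordinate is itself a functional. *)
Lemma is_pathP T p : is_path T p <->
  [/\ forall f, cont T (f \o p), p 0 = 0 & on0T T p = p].
Proof.
pose e := vbasis {:V}; split=> -[pc p0 pT]; split=> //.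
  move=> f.
  apply: (@cont_eq _ _ (fun t => \sum_(i < \dim {:V}) f e`_i * coord e i (p t))).
    move=> t _ /=; rewrite {2}(coord_vbasis (memvf (p t))) linear_sum.
    by apply: eq_bigr => i _; rewrite linearZ mulrC.
  apply: cont_sum => i; apply/contP => t.
  have -> : (fun t => coord e i (p t)) = (fun M : 'rV_(\dim {:V}) => M 0 i) \o
      (passmx.rVof e \o p).
    by apply/funext => s /=; rewrite -passmx.coord_rVof.
  apply: (@continuous_comp (subspace `[0, T]%classic) _ _ _ _ t (pc t)).
  exact: coord_continuous.
apply/subspace_continuousP => t tT; apply/cvg_ballP => eps eps0.
have H i : \forall s \near within `[0, T] (nbhs t),
    ball (coord e i (p t)) eps (coord e i (p s)).
  have /contP/subspace_continuousP/(_ t tT)/cvg_ballP := pc (coord e i).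
  by apply.
near=> s; split=> // i j; rewrite ord1 /= -!passmx.coord_rVof.
by move: j; near: s; apply: filter_forall => j; exact: H.
Unshelve. all: by end_near. Qed.

Lemma path_cont T p f : is_path T p -> cont T (f \o p).
Proof. by case/is_pathP => + _ _; exact. Qed.

Lemma path0 T p : is_path T p -> p 0 = 0.
Proof. by case. Qed.

Lemma path_ext T p q : is_path T p -> is_path T q ->
  (forall t, 0 <= t <= T -> p t = q t) -> p = q.
Proof. by move=> [_ _ pT] [_ _ qT] /eq_on0T; rewrite pT qT. Qed.

Lemma is_path_on0T T p : 0 <= T -> (forall f, cont T (f \o p)) -> p 0 = 0 ->
  is_path T (on0T T p).
Proof.
move=> T0 pc p0; apply/is_pathP; split=> [f||]; last exact: on0TK.
  by apply: cont_eq (pc f) => t tT; rewrite /= /on0T tT.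
by rewrite /on0T p0 if_same.
Qed.

Lemma on0TE T p t : 0 <= t <= T -> on0T T p t = p t.
Proof. by rewrite /on0T => ->. Qed.

Lemma path_linear T (L : {linear V -> V}) p : is_path T p -> is_path T (L \o p).
Proof.
move=> /is_pathP[pc p0 pT]; apply/is_pathP; split=> [f||]; first exact: (pc (f \o L)).
  by rewrite /= p0 linear0.
apply/funext => t; rewrite /on0T; case: ifPn => // /negbTE tT /=.
by rewrite -pT /on0T tT linear0.
Qed.

Lemma cont_rev T (g : R -> R) : cont T g -> cont T (fun t => g (T - t)).
Proof.
move=> gc x xT e e0; have [|d d0 dP] := gc (T - x) _ e e0; first by lra.
exists d => // y yT yx; apply: dP; first by lra.
by rewrite (_ : _ - _ = - (y - x)) ?normrN //; ring.
Qed.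

Lemma kappaE T p t : 0 <= t <= T -> kappa T p t = p (T - t) - p T.
Proof. exact: on0TE. Qed.

Lemma kappa_path T p : 0 <= T -> is_path T p -> is_path T (kappa T p).
Proof.
move=> T0 pp; apply: is_path_on0T => // [f|]; last by rewrite subr0 subrr.
apply: (@cont_eq _ _ (fun t => f (p (T - t)) + (-1) * f (p T))).
  by move=> t _ /=; rewrite linearB; ring.
apply: cont_comb; first exact: (cont_rev (path_cont f pp)).
by move=> x xT e e0; exists 1 => // y _ _; rewrite subrr normr0.
Qed.

Lemma kappaK T p : 0 <= T -> is_path T p -> kappa T (kappa T p) = p.
Proof.
move=> T0 pp; apply: (path_ext _ pp); first by do 2![apply: kappa_path => //].
move=> t tT; rewrite (kappaE _ tT) kappaE; last by lra.
rewrite kappaE; last by lra.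
by rewrite subrr subKr (path0 pp) sub0r opprK subrK.
Qed.

Lemma cont_concat T (g h : R -> R) : 0 < T -> cont T g -> cont T h -> h 0 = 0 ->
  cont T (fun t => if t <= T / 2 then g (2 * t) else g T + h (2 * (t - T / 2))).
Proof.
move=> T0 gc hc h0 x xT e e0.
have [xl|xr] := ltP x (T / 2).
  have [|d d0 dP] := gc (2 * x) _ e e0; first by lra.
  exists (Num.min (d / 2) (T / 2 - x)); first by rewrite lt_min; lra.
  move=> y yT; rewrite lt_min !ltr_norml => yx.
  have -> : x <= T / 2 by lra.
  have -> : y <= T / 2 by lra.
  by have := dP (2 * y); rewrite !ltr_norml; apply; lra.
have [|d d0 dP] := hc (2 * (x - T / 2)) _ e e0; first by lra.
have [xr'|xl] := ltP (T / 2) x.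
  exists (Num.min (d / 2) (x - T / 2)); first by rewrite lt_min; lra.
  move=> y yT; rewrite lt_min !ltr_norml => yx.
  have -> : (y <= T / 2) = false by apply/negbTE; rewrite -ltNge; lra.
  have := dP (2 * (y - T / 2)); rewrite !ltr_norml => H.
  have : - e < h (2 * (y - T / 2)) - h (2 * (x - T / 2)) < e by apply: H; lra.
  by lra.
have xE : x = T / 2 by lra.
subst x; have [|d' d'0 dP'] := gc T _ e e0; first by lra.
exists (Num.min (d / 2) (d' / 2)); first by rewrite lt_min; lra.
move=> y yT; rewrite lt_min !ltr_norml => yx.
rewrite (_ : 2 * (T / 2) = T); last by field.
case: (leP y (T / 2)) => yh.
  have := dP' (2 * y); rewrite !ltr_norml; apply; lra.
have := dP (2 * (y - T / 2)); rewrite subrr mulr0 h0 !ltr_norml => H.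
have : - e < h (2 * (y - T / 2)) - 0 < e by apply: H; lra.
by lra.
Qed.

Lemma concat_path T p q : 0 < T -> is_path T p -> is_path T q -> is_path T (concat T p q).
Proof.
move=> T0 pp qp; apply: is_path_on0T => [|f|]; first by lra.
  apply: (@cont_eq _ _ (fun t => if t <= T / 2 then f (p (2 * t))
      else f (p T) + f (q (2 * (t - T / 2))))).
    by move=> t _ /=; case: ifP => // _; rewrite linearD.
  apply: (cont_concat T0 (path_cont f pp) (path_cont f qp)).
  by rewrite /= (path0 qp) linear0.
by rewrite mulr0 (path0 pp) ifT //; lra.
Qed.

Lemma concatEl T p q t : 0 <= t <= T / 2 -> concat T p q t = p (2 * t).
Proof. by move=> tT; rewrite /concat on0TE; [rewrite ifT //; lra | lra]. Qed.

Lemma concatEr T p q t : q 0 = 0 -> T / 2 <= t <= T ->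
  concat T p q t = p T + q (2 * (t - T / 2)).
Proof.
move=> q0 tT; rewrite /concat on0TE; last by lra.
case: ifP => // tT2; have -> : t = T / 2 by lra.
by rewrite subrr mulr0 q0 addr0; congr p; field.
Qed.

Lemma kappa_concat T p q : 0 < T -> is_path T p -> is_path T q ->
  kappa T (concat T p q) = concat T (kappa T q) (kappa T p).
Proof.
move=> T0 pp qp; have T0' := ltW T0; have pk := kappa_path T0' pp; have qk := kappa_path T0' qp.
apply: (path_ext (kappa_path T0' (concat_path T0 pp qp)) (concat_path T0 qk pk)) => t tT.
have t1 : T / 2 <= T <= T by lra.
have ETE : concat T p q T = p T + q T.
  by rewrite concatEr ?(path0 qp) //; congr (_ + q _); field.
rewrite kappaE // ETE; case: (leP t (T / 2)) => th.
  have [t2 t3 t4] : [/\ T / 2 <= T - t <= T, 0 <= t <= T / 2 & 0 <= 2 * t <= T] by split; lra.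
  rewrite (concatEr _ (path0 qp)) // (concatEl _ _ t3) kappaE //.
  rewrite (_ : 2 * (T - t - T / 2) = T - 2 * t); last by field.
  by rewrite opprD addrACA subrr add0r.
have [t2 t3] : 0 <= T - t <= T / 2 /\ T / 2 <= t <= T by split; lra.
have [t4 t5] : 0 <= 2 * (t - T / 2) <= T /\ 0 <= T <= T by split; lra.
rewrite (concatEr _ (path0 pk)) // (concatEl _ _ t2) !kappaE //.
rewrite subrr (path0 qp) sub0r (_ : 2 * (T - t) = T - 2 * (t - T / 2)); last by field.
by rewrite opprD [RHS]addrC addrA addrAC.
Qed.

End PathOperators.

(** * A single transform, its fibres, and concatenation *)

Section PitmanTransform.
Context {R : realType} {V : vectType R} (T : R) (f : {scalar V}) (al : V).
Hypotheses (T0 : 0 < T) (fal : f al = 2).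
Implicit Types (p q : R -> V).

Local Notation P := (pit T f al).
Local Notation I p := (runinf (f \o p)).

Lemma pit_path p : is_path T p -> is_path T (P p).
Proof.
move=> pp; have T0' := ltW T0; apply: is_path_on0T => // [g|].
  apply: (@cont_eq _ _ (fun t => g (p t) + (- g al) * I p t)).
    by move=> t tT /=; rewrite scalarBZ; ring.
  by apply: cont_comb; [exact: path_cont pp | exact: cont_runinf (path_cont f pp)].
by rewrite (path0 pp) (runinf0 (path_cont f pp) T0') /= (path0 pp) linear0 scale0r subr0.
Qed.

Lemma runinf_le0 p t : is_path T p -> 0 <= t <= T -> I p t <= 0.
Proof.
move=> pp tT; rewrite -(linear0 f) -(path0 pp).
by apply: (runinf_le (path_cont f pp)); lra.
Qed.

Lemma pit_ge0 p t : is_path T p -> 0 <= t <= T -> 0 <= f (P p t).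
Proof.
move=> pp tT; rewrite pitE // scalarBZ fal.
have : I p t <= f (p t) by apply: (runinf_le (path_cont f pp)); lra.
by have := runinf_le0 pp tT; lra.
Qed.

Lemma runinf_eq0 p t : is_path T p -> 0 <= t <= T ->
  (forall s, 0 <= s <= t -> 0 <= f (p s)) -> I p t = 0.
Proof.
move=> pp tT p0; apply/eqP; rewrite eq_le runinf_le0 //=.
exact: (le_runinf (path_cont f pp)).
Qed.

Lemma pit_id p : is_path T p -> (forall t, 0 <= t <= T -> 0 <= f (p t)) -> P p = p.
Proof.
move=> pp p0; apply: (path_ext (pit_path pp) pp) => t tT.
rewrite pitE // runinf_eq0 ?scale0r ?subr0 // => s st.
by apply: p0; lra.
Qed.

Lemma pit_idem p : is_path T p -> P (P p) = P p.
Proof.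
by move=> pp; apply: pit_id => [|t]; [exact: pit_path | exact: pit_ge0].
Qed.

Lemma pit_end p : P p T = p T - I p T *: al.
Proof. by apply: pitE; rewrite ltW //= lexx. Qed.

Lemma runinf_kappa p : is_path T p ->
  I (kappa T p) T = I p T - f (p T).
Proof.
move=> pp; have T0' := ltW T0; have kp := kappa_path T0' pp.
have TT : 0 <= T <= T by lra.
have [s sP [-> sM]] := runinf_attained (path_cont f kp) TT.
have [r rP [-> rM]] := runinf_attained (path_cont f pp) TT.
move: sM rM => /= sM rM; rewrite kappaE // (scalarB f).
have r1 : 0 <= T - r <= T by lra.
have := sM _ r1; rewrite !kappaE // !(scalarB f) subKr.
have s1 : 0 <= T - s <= T by lra.
by have := rM _ s1; lra.
Qed.

(* This is the classical 2M - X identity, applied to the reversed path. *)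
Lemma pit_kappa_pit p : is_path T p -> P (kappa T (P p)) = P (kappa T p).
Proof.
move=> pp; have T0' := ltW T0; have kp := kappa_path T0' pp.
have Pp := pit_path pp; have kPp := kappa_path T0' Pp.
apply: (path_ext (pit_path kPp) (pit_path kp)) => t tT.
have v0 : 0 <= T - t by lra.
have vT : T - t <= T by lra.
have gc := path_cont f pp; have TT : 0 <= T <= T by lra.
have hE u : 0 <= u <= T -> f (kappa T p u) = f (p (T - u)) - f (p T).
  by move=> uT; rewrite kappaE // (scalarB f).
have hE' u : 0 <= u <= T -> f (kappa T (P p) u) =
    f (p (T - u)) - 2 * I p (T - u) - (f (p T) - 2 * I p T).
  move=> uT; rewrite kappaE // (scalarB f) !pitE ?(scalarBZ f) ?fal //; last by lra.
  ring.
have E : I (kappa T (P p)) t = I (kappa T p) t + (I p T - I p (T - t)).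
  apply/eqP; rewrite eq_le; apply/andP; split.
    have [s sP [-> _]] := runinf_attained (path_cont f kp) tT.
    have sT : 0 <= s <= T by lra.
    have [q1 q2] : T - t <= T - s /\ T - s <= T by split; lra.
    have [u uP uE] := pitman_ineq_rev gc v0 q1 q2 (lexx T).
    have uT : 0 <= T - u <= T by lra.
    apply: (@le_trans _ _ (f (kappa T (P p) (T - u)))).
      by apply: (runinf_le (path_cont f kPp)); lra.
    rewrite (hE' _ uT) /= (hE _ sT) subKr; move: uE; rewrite /=; lra.
  have [s sP [-> _]] := runinf_attained (path_cont f kPp) tT.
  have sT : 0 <= s <= T by lra.
  have [q1 q2] : T - t <= T - s /\ T - s <= T by split; lra.
  have [u uP uE] := pitman_ineq gc v0 q1 q2 (lexx T).
  have uT : 0 <= T - u <= T by lra.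
  have : I (kappa T p) t <= f (kappa T p (T - u)).
    by apply: (runinf_le (path_cont f kp)); lra.
  rewrite (hE _ uT) /= (hE' _ sT) subKr; move: uE; rewrite /=; lra.
have zid (a b x y z : V) : a - x - (b - y) - (z + (y - x)) = a - b - z.
  by rewrite opprB [y - b]addrC addrACA [- x + y]addrC [z + _]addrC opprD addrA addrK.
have vv : 0 <= T - t <= T by lra.
by rewrite !pitE // E !kappaE // !pitE // scalerDl scalerBl zid.
Qed.

(* This is E^x p for x >= 0, with c = - I p T - x / 2. *)
Definition raise (c : R) p := on0T T (fun t => p t - Num.min 0 (c + I p t) *: al).

Lemma cont_min T' (g h : R -> R) : cont T' g -> cont T' h -> cont T' (fun t => Num.min (g t) (h t)).
Proof.
move=> gc hc x xT e e0; have [d1 d10 P1] := gc x xT e e0; have [d2 d20 P2] := hc x xT e e0.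
exists (Num.min d1 d2); first by rewrite lt_min d10.
move=> y yT; rewrite lt_min => /andP[/(P1 _ yT) y1 /(P2 _ yT) y2].
move: y1 y2; rewrite !ltr_norml => y1 y2.
by case: (leP (g y) (h y)); case: (leP (g x) (h x)); lra.
Qed.

Lemma cont_cst T' (c : R) : cont T' (fun=> c).
Proof. by move=> x xT e e0; exists 1 => // y _ _; rewrite subrr normr0. Qed.

Lemma raise_path c p : 0 <= c -> is_path T p -> is_path T (raise c p).
Proof.
move=> c0 pp; have T0' := ltW T0; apply: is_path_on0T => // [g|].
  apply: (@cont_eq _ _ (fun t => g (p t) + (- g al) * Num.min 0 (c + 1 * I p t))).
    by move=> t tT /=; rewrite scalarBZ mul1r; ring.
  apply: cont_comb; first exact: path_cont pp.
  apply: cont_min; first exact: cont_cst.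
  by apply: cont_comb; [exact: cont_cst | exact: cont_runinf (path_cont f pp)].
rewrite (path0 pp) (runinf0 (path_cont f pp) T0') /= (path0 pp) linear0 addr0.
by rewrite min_l // scale0r subr0.
Qed.

Lemma raiseE c p t : 0 <= t <= T -> raise c p t = p t - Num.min 0 (c + I p t) *: al.
Proof. exact: on0TE. Qed.

(** Let J be the running infimum of [f] along [p]. Once J is below [- c], the raised value is at
    least J - 2 (c + J), hence at least [- c]; equality holds at a time when the path hits its
    running infimum at level [- c]. *)
Lemma runinf_raise c p t : 0 <= c -> is_path T p -> 0 <= t <= T ->
  I (raise c p) t = Num.max (I p t) (- c).
Proof.
move=> c0 pp tT; have rp := raise_path c0 pp; have gc := path_cont f pp.
have rE s : 0 <= s <= T -> f (raise c p s) = f (p s) - 2 * Num.min 0 (c + I p s).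
  by move=> sT; rewrite raiseE // scalarBZ fal mulrC.
have [t0 tT'] : 0 <= t /\ t <= T by split; lra.
apply/eqP; rewrite eq_le; apply/andP; split; last first.
  apply: (le_runinf (path_cont f rp)) => // s sP /=; rewrite rE; last by lra.
  have h1 : I p s <= f (p s) by apply: (runinf_le gc); lra.
  have h2 : I p t <= I p s by apply: (runinf_anti gc).
  by rewrite ge_max; case: (leP 0 (c + I p s)); lra.
have [ge|lt] := leP (- c) (I p t).
  have [s sP [IE _]] := runinf_attained gc tT.
  have : I (raise c p) t <= f (raise c p s) by apply: (runinf_le (path_cont f rp)); lra.
  rewrite rE; last by lra.
  have h1 : I p t <= I p s by apply: (runinf_anti gc).
  by move: IE => /=; case: (leP 0 (c + I p s)); lra.
have I0 : I p 0 = 0 by rewrite (runinf0 gc) ?ltW //= (path0 pp) linear0.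
have t00 : 0 <= (0 : R) <= t by rewrite lexx.
have lt' : I p t < - c <= I p 0 by rewrite I0 lt oppr_le0.
have [s sP [gs Is]] := first_hit gc t00 tT' lt'.
have : I (raise c p) t <= f (raise c p s) by apply: (runinf_le (path_cont f rp)); lra.
rewrite rE; last by lra.
by move: gs => /=; rewrite Is; case: (leP 0 (c - c)); lra.
Qed.

Lemma pit_raise c p : 0 <= c -> is_path T p -> P (raise c p) = P p.
Proof.
move=> c0 pp; apply: (path_ext (pit_path (raise_path c0 pp)) (pit_path pp)) => t tT.
rewrite !pitE // runinf_raise // raiseE // -addrA -opprD -scalerDl; congr (_ - _ *: _).
by case: (leP 0 (c + I p t)); case: (leP (I p t) (- c)); lra.
Qed.

(** Raising handles [x >= 0]. For [x < 0] the reversed path is raised and reversed back;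
    [pit_kappa_pit] ensures that the transform does not change. *)
Lemma littelmann_exists p x : is_path T p ->
  - 2 * f (p T) + 2 * I p T <= x <= - 2 * I p T ->
  exists q, [/\ is_path T q, P q = P p & f (q T) = f (p T) + x].
Proof.
move=> pp xr; have T0' := ltW T0; have TT : 0 <= T <= T by lra.
have kp := kappa_path T0' pp.
have [x0|x0] := leP 0 x.
  (* With this constant [c + I p T] is [- x / 2], so the coroot value of the end point grows by
     [x]. *)
  have c0 : 0 <= - I p T - x / 2 by lra.
  exists (raise (- I p T - x / 2) p); split; [exact: raise_path|exact: pit_raise|].
  by rewrite raiseE // scalarBZ fal; case: (leP 0 (- I p T - x / 2 + I p T)); lra.
pose c := - I (kappa T p) T + x / 2.
have kE := runinf_kappa pp.
have c0 : 0 <= c by rewrite /c kE; lra.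
have rp := raise_path c0 kp.
exists (kappa T (raise c (kappa T p))); split; first exact: kappa_path.
  rewrite -pit_kappa_pit ?pit_raise // pit_kappa_pit //.
  by rewrite kappaK.
rewrite kappaE // subrr (path0 rp) sub0r raiseE // scalarN scalarBZ fal.
rewrite kappaE // subrr (path0 pp) sub0r scalarN /c.
by case: leP; lra.
Qed.

(** The infima agree at [T], and f - 2 I is the same function for both paths. If I p t < I q t = v,
    there is a later time [s] where [q] has value and infimum v, so the common function is -v; for
    [p] it is at least - I p s >= - I p t > -v. *)
Lemma littelmann_unique p q : is_path T p -> is_path T q -> P p = P q ->
  f (p T) = f (q T) -> p = q.
Proof.
move=> pp qp E fE; have TT : 0 <= T <= T by move: T0; lra.
have gE t : 0 <= t <= T -> f (p t) - 2 * I p t = f (q t) - 2 * I q t.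
  by move=> tT; have := congr1 f (congr1 (@^~ t) E); rewrite !pitE // !scalarBZ fal; lra.
have IT : I p T = I q T by have := gE T TT; lra.
have key p1 q1 t : is_path T p1 -> is_path T q1 -> 0 <= t <= T ->
    (forall s, 0 <= s <= T -> f (p1 s) - 2 * I p1 s = f (q1 s) - 2 * I q1 s) ->
    I p1 T = I q1 T -> I q1 t <= I p1 t.
  move=> pp1 qp1 tT g1 I1; rewrite leNgt; apply/negP => lt.
  have h : I p1 T <= I p1 t by apply: (runinf_anti (path_cont f pp1)); lra.
  have [tT' tT''] : 0 <= t <= T /\ I q1 T < I q1 t <= I q1 t by split; lra.
  have [s sP [gs Is]] := first_hit (path_cont f qp1) tT' (lexx T) tT''.
  have sT : 0 <= s <= T by lra.
  have h1 : I p1 s <= f (p1 s) by apply: (runinf_le (path_cont f pp1)); lra.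
  have h2 : I p1 s <= I p1 t by apply: (runinf_anti (path_cont f pp1)); lra.
  have := g1 s sT; move: gs => /= gs; rewrite gs Is; lra.
apply: (path_ext pp qp) => t tT.
have IE : I p t = I q t.
  apply/eqP; rewrite eq_le !key // => s sT; by rewrite gE.
have := congr1 (@^~ t) E; rewrite !pitE // IE; exact: addIr.
Qed.

(** On the second half the infimum is the smaller of [I p T] and [f (p T)] plus that of [q], which
    is [I p T] plus the correction used by [raise]. *)
Lemma pit_concat p q : is_path T p -> is_path T q ->
  P (concat T p q) = concat T (P p) (raise (f (p T) - I p T) q).
Proof.
move=> pp qp; have T0' := ltW T0; have TT : 0 <= T <= T by lra.
have c0 : 0 <= f (p T) - I p T.
  by rewrite subr_ge0; apply: (runinf_le (path_cont f pp)); lra.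
set c := f (p T) - I p T in c0 *.
have rp := raise_path c0 qp; have cp := concat_path T0 pp qp.
apply: (path_ext (pit_path cp) (concat_path T0 (pit_path pp) rp)) => t tT.
rewrite pitE //.
have IL s : 0 <= s <= T / 2 -> I (concat T p q) s = I p (2 * s).
  move=> sT; have [s1 s2] : 0 <= s <= T /\ 0 <= 2 * s <= T by split; lra.
  apply/eqP; rewrite eq_le; apply/andP; split.
    have [u uP [-> _]] := runinf_attained (path_cont f pp) s2.
    have -> : (f \o p) u = (f \o concat T p q) (u / 2).
      rewrite /= concatEl; last by lra.
      by congr (f (p _)); field.
    by apply: (runinf_le (path_cont f cp)); lra.
  have [u uP [-> _]] := runinf_attained (path_cont f cp) s1.
  rewrite /= concatEl; last by lra.
  by apply: (runinf_le (path_cont f pp)); lra.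
have [th|th] := leP t (T / 2).
  have [t1 t2] : 0 <= t <= T / 2 /\ 0 <= 2 * t <= T by split; lra.
  by rewrite IL // !concatEl // pitE.
have t1 : T / 2 <= t <= T by lra.
have t2 : 0 <= 2 * (t - T / 2) <= T by lra.
rewrite !concatEr ?(path0 rp) ?(path0 qp) // pit_end raiseE //.
set u := 2 * (t - T / 2) in t2 *.
have -> : I (concat T p q) t = I p T + Num.min 0 (c + I q u).
  apply/eqP; rewrite eq_le; apply/andP; split.
    have h1 : I (concat T p q) t <= I p T.
      have <- : I (concat T p q) (T / 2) = I p T.
        by rewrite IL; [congr runinf; field | lra].
      by apply: (runinf_anti (path_cont f cp)); lra.
    have h2 : I (concat T p q) t <= f (p T) + I q u.
      have [r rP [-> _]] := runinf_attained (path_cont f qp) t2.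
      have -> : f (p T) + (f \o q) r = (f \o concat T p q) (r / 2 + T / 2).
        rewrite /= concatEr ?(path0 qp) //; last by lra.
        by rewrite linearD; congr (_ + f (q _)); field.
      by apply: (runinf_le (path_cont f cp)); rewrite /u in rP; lra.
    by have cE : c = f (p T) - I p T by []; case: (leP 0 (c + I q u)); lra.
  apply: (le_runinf (path_cont f cp)) => // s sP /=.
  have [sh|sh] := leP s (T / 2).
    rewrite concatEl; last by lra.
    have : I p T <= f (p (2 * s)) by apply: (runinf_le (path_cont f pp)); lra.
    by case: (leP 0 (c + I q u)); lra.
  rewrite concatEr ?(path0 qp) //; last by lra.
  rewrite linearD.
  have : I q u <= f (q (2 * (s - T / 2))) by apply: (runinf_le (path_cont f qp)); rewrite /u; lra.
  by have cE : c = f (p T) - I p T by []; case: (leP 0 (c + I q u)); lra.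
by rewrite scalerDl opprD addrACA.
Qed.

End PitmanTransform.

(** * Highest paths and the involution *)

Section Crystal.
Context {R : realType} {V : vectType R} (Phi : rootSystem V) (T : R).
Variables (w0 : V -> V) (ws : seq 'I_(rank Phi)).
Hypotheses (w0L : longest_element Phi w0) (w0E : reduced_decomposition w0 ws).
Hypothesis T0 : 0 < T.
Implicit Types (i j : 'I_(rank Phi)) (u v : seq 'I_(rank Phi)) (p q : R -> V).

Local Notation al := (@simple _ _ Phi).
Local Notation s := (simple_refl (Phi := Phi)).
Local Notation W := (weyl_word (Phi := Phi)).
Local Notation co := (@simple_coroot _ _ Phi).
Local Notation pos := (pos Phi).
Local Notation P i := (pit T (co i) (al i)).
Local Notation Pw := (pit_word T co al).
Local Notation I i p := (runinf (co i \o p)).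
Local Notation D := (Pw ws).

Let T0' : 0 <= T := ltW T0.
Let TT : 0 <= T <= T. Proof. by rewrite T0' lexx. Qed.
Let fal i : co i (al i) = 2 := co_simple i.

Lemma word_path u p : is_path T p -> is_path T (Pw u p).
Proof. by move=> pp; elim: u => //= i u; exact: pit_path. Qed.

Lemma word_eq u v p : reduced u -> reduced v -> W u =1 W v -> is_path T p ->
  Pw u p = Pw v p /\ (string_int T co al u p <-> string_int T co al v p).
Proof.
move=> ru rv E pp; apply: (reduced_braid_equiv T0' ru rv E) => i.
exact: path_cont pp.
Qed.

Let rws : reduced ws := longest_reduced w0E.

Lemma dominant_left i p : is_path T p -> P i (D p) = D p.
Proof.
move=> pp; have [v [rv E]] := longest_cons w0L w0E i.
have [<- _] := word_eq rv rws E pp.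
by apply: pit_idem => //; exact: word_path.
Qed.

Lemma dominant_right i p : is_path T p -> D (P i p) = D p.
Proof.
move=> pp; have [v [rv E]] := longest_rcons w0L w0E i.
have [<- _] := word_eq rv rws E pp.
have [<- _] := word_eq rv rws E (pit_path (co i) (al i) T0 pp).
by rewrite !pit_word_rcons pit_idem.
Qed.

Lemma dominant_right_word u p : is_path T p -> D (Pw u p) = D p.
Proof. by move=> pp; elim: u => //= i u <-; apply: dominant_right; exact: word_path. Qed.

Lemma dominant_ge0 p : is_path T p -> dominant T Phi (D p).
Proof.
move=> pp i t tT; rewrite -(dominant_left i pp).
by apply: pit_ge0 => //; exact: word_path.
Qed.

Lemma dominant_id p : is_path T p -> dominant T Phi p -> forall u, Pw u p = p.
Proof. by move=> pp pd; elim=> //= i u ->; apply: pit_id => // t; exact: pd. Qed.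

Definition negw0 : {linear V -> V} := (-%R \o W ws).

Definition sdual p : R -> V := negw0 \o kappa T p.

Lemma dual_path p : is_path T p -> is_path T (sdual p).
Proof. by move=> pp; apply: path_linear; exact: kappa_path. Qed.

Lemma dualE p t : 0 <= t <= T -> sdual p t = W ws (p T) - W ws (p (T - t)).
Proof. by move=> tT; rewrite /sdual /= kappaE // linearB opprB. Qed.

Lemma dual_end p : is_path T p -> sdual p T = W ws (p T).
Proof. by move=> pp; rewrite dualE // subrr (path0 pp) linear0 subr0. Qed.

Lemma dualK p : is_path T p -> sdual (sdual p) = p.
Proof.
move=> pp; have dp := dual_path pp.
apply: (path_ext (dual_path dp) pp) => t tT; have tT' : 0 <= T - t <= T by lra.
have wB x y : W ws (x - y) = W ws x - W ws y by exact: linearB.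
rewrite dualE // !dualE // subrr (path0 pp) linear0 subr0 subKr.
by rewrite wB !(longest_inv w0L w0E) subKr.
Qed.

Lemma pit_negw0 i j p : is_path T p -> negw0 (al i) = al j ->
  P j (negw0 \o p) = negw0 \o P i p.
Proof.
move=> pp ij; have np := path_linear negw0 pp.
have Pp := pit_path (co i) (al i) T0 pp.
apply: (path_ext (pit_path _ _ T0 np) (path_linear negw0 Pp)) => t tT.
have nBZ x c y : negw0 (x - c *: y) = negw0 x - c *: negw0 y by rewrite linearB linearZ.
rewrite pitE // -[RHS]/(negw0 (P i p t)) pitE // nBZ ij.
by congr (_ - _ *: _); apply: eq_runinf => r _ /=; exact: coroot_star.
Qed.

Lemma dual_pit i j p : is_path T p -> negw0 (al i) = al j ->
  P j (sdual (P i p)) = P j (sdual p).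
Proof.
move=> pp ij; have kp := kappa_path T0' pp.
have Pp := pit_path (co i) (al i) T0 pp; have kPp := kappa_path T0' Pp.
by rewrite /sdual !(pit_negw0 _ ij) // pit_kappa_pit.
Qed.

(** A letter [i] of [u] is absorbed after [sdual] by the transform for the opposite root [j], which
    [D] absorbs in turn. *)
Lemma dominant_dual_word u p : is_path T p -> D (sdual (Pw u p)) = D (sdual p).
Proof.
move=> pp; elim: u => //= i u <-; have wp := word_path u pp.
have [j ij] := longest_star w0L w0E i.
rewrite -(dominant_right j (dual_path wp)) -(dual_pit wp ij).
by rewrite dominant_right //; apply: dual_path; exact: pit_path.
Qed.

Definition involution p := D (sdual p).

Lemma involution_path p : is_path T p -> is_path T (involution p).
Proof. by move=> pp; apply: word_path; exact: dual_path. Qed.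

Lemma involution_dominant p : is_path T p -> dominant T Phi (involution p).
Proof. by move=> pp; apply: dominant_ge0; exact: dual_path. Qed.

Lemma involution_eq p q : is_path T p -> is_path T q -> D p = D q ->
  involution p = involution q.
Proof.
by move=> pp qp E; rewrite /involution -(dominant_dual_word ws pp) E dominant_dual_word.
Qed.

Lemma involutionK p : is_path T p -> dominant T Phi p -> involution (involution p) = p.
Proof.
move=> pp pd; have dp := dual_path pp.
by rewrite {1}/involution dominant_dual_word // dualK // dominant_id.
Qed.

Lemma pit_end_shift i p q : P i p = P i q ->
  q T = p T + ((co i (q T) - co i (p T)) / 2) *: al i.
Proof.
move=> /(congr1 (@^~ T)); rewrite !pitE // => E.
have := congr1 (co i) E; rewrite !scalarBZ fal => E'.
have -> : (co i (q T) - co i (p T)) / 2 = I i q T - I i p T by lra.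
by rewrite scalerBl addrCA E addrC subrK.
Qed.

Lemma word_end_pos u p : is_path T p -> pos (Pw u p T - p T).
Proof.
move=> pp; elim: u => [|i u IH] /=; first by rewrite subrr; exact: pos0.
rewrite pitE // addrAC; apply: pos_add => //; rewrite -scaleNr; apply: pos_scale.
  by rewrite oppr_ge0; exact: (runinf_le0 (co i) (word_path u pp) TT).
exact: pos_simple.
Qed.

(** Moving along the [i]-string by [- 2 * co i (q T)] negates the coroot value of the end point,
    that is, reflects it, without changing the dominant path. *)
Lemma weyl_end u p : is_path T p -> exists q, [/\ is_path T q, D q = D p & q T = W u (p T)].
Proof.
move=> pp; elim: u => [|i u [q [qp Dq qT]]]; first by exists p.
have [|r [rp rE rT]] := littelmann_exists T0 (fal i) (x := - 2 * co i (q T)) qp.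
  have : I i q T <= co i (q T) by apply: (runinf_le (path_cont (co i) qp)).
  by have := runinf_le0 (co i) qp TT; lra.
exists r; split=> //; first by rewrite -(dominant_right i) // rE dominant_right.
rewrite (pit_end_shift (esym rE)) rT /= -qT /simple_refl -scaleNr.
by congr (_ + _ *: _); field.
Qed.

Lemma weyl_end_pos u p : is_path T p -> pos (D p T - W u (p T)).
Proof. by move=> pp; have [q [qp <- <-]] := weyl_end u pp; exact: word_end_pos. Qed.

(** [sdual q] ends at the image of [q T] under the longest element, so [weyl_end_pos] puts [q T]
    below [involution q T] for every path. Using this for [p] and for [involution p] gives both
    inequalities. *)
Lemma involution_end p : is_path T p -> dominant T Phi p -> involution p T = p T.
Proof.
move=> pp pd.
have H q : is_path T q -> pos (involution q T - q T).
  move=> qp; have := weyl_end_pos ws (dual_path qp).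
  by rewrite dual_end // (longest_inv w0L w0E).
have h1 := H _ pp; have := H _ (involution_path pp).
rewrite involutionK // -opprB => h2.
by apply/eqP; rewrite -subr_eq0; apply/eqP; exact: pos_anti h1 h2.
Qed.

(** Lower [q] as far as possible along [i], by c. The new end point, moved by the inverse of [W u]
    and then by the longest element, must stay below [p T]; it is [p T] minus c times a negative
    root, since [i :: u] is reduced. Hence c = 0. *)
Lemma extremal_step p i u : is_path T p -> dominant T Phi p -> reduced (i :: u) ->
  Pw u (sdual p) T = W u (W ws (p T)) ->
  I i (Pw u (sdual p)) T = co i (Pw u (sdual p) T).
Proof.
move=> pp pd ru; set q := Pw u (sdual p) => qT.
have qp : is_path T q by apply: word_path; exact: dual_path.
have h1 : I i q T <= co i (q T) by apply: (runinf_le (path_cont (co i) qp)).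
have h2 := runinf_le0 (co i) qp TT.
pose c := co i (q T) - I i q T; have c0 : 0 <= c by rewrite subr_ge0.
have [|r [rp rE rT]] := littelmann_exists T0 (fal i) (x := - 2 * c) qp; first by rewrite /c; lra.
have rTE : r T = q T - c *: al i.
  by rewrite (pit_end_shift (esym rE)) rT -scaleNr; congr (_ + _ *: _); field.
have Dr : D r T = p T.
  rewrite -(dominant_right i rp) rE (dominant_right i qp) /q.
  by rewrite (dominant_right_word u (dual_path pp)); exact: involution_end.
have := weyl_end_pos (ws ++ rev u) rp.
rewrite Dr rTE weyl_word_cat !weyl_wordBZ qT weyl_wordK (longest_inv w0L w0E).
rewrite opprB addrC subrK => h.
have b : pos (W (rev u) (al i)).
  by have := reduced_rev ru; rewrite rev_cons => /reduced_rcons_pos.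
have h' : pos (- (c *: W ws (W (rev u) (al i)))).
  by rewrite -scalerN; apply: pos_scale => //; exact: (longest_pos w0L w0E b).
have /eqP := pos_anti h h'; rewrite scaler_eq0 => /orP[|].
  by rewrite -qT subr_eq0 => /eqP.
by rewrite -weyl_word_cat (negbTE (root_neq0 (weyl_root _ (simple_root i)))).
Qed.

Lemma extremal_end p x u : is_path T p -> dominant T Phi p -> ws = x ++ u ->
  Pw u (sdual p) T = W u (W ws (p T)).
Proof.
move=> pp pd; elim: u x => [|i u IH] x wE; first by rewrite /= dual_end.
have E := IH (rcons x i); rewrite cat_rcons in E; have {}E := E wE.
have ru : reduced (i :: u) by apply: (reduced_catr (u := x)); rewrite -wE.
by rewrite /= pitE // (extremal_step pp pd ru E) -E.
Qed.

Lemma extremal p x i u : is_path T p -> dominant T Phi p -> ws = x ++ i :: u ->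
  I i (Pw u (sdual p)) T = co i (Pw u (sdual p) T).
Proof.
move=> pp pd wE; apply: extremal_step => //.
  by apply: (reduced_catr (u := x)); rewrite -wE.
by apply: (extremal_end (x := rcons x i)) => //; rewrite cat_rcons.
Qed.

End Crystal.

(** * Littelmann modules *)

Section LittelmannModules.
Context {R : realType} {V : vectType R} (Phi : rootSystem V) (T : R).
Variables (w0 : V -> V) (ws : seq 'I_(rank Phi)).
Hypotheses (w0L : longest_element Phi w0) (w0E : reduced_decomposition w0 ws).
Hypothesis T0 : 0 < T.
Implicit Types (i j : 'I_(rank Phi)) (u v : seq 'I_(rank Phi)) (p q : R -> V).

Local Notation al := (@simple _ _ Phi).
Local Notation W := (weyl_word (Phi := Phi)).
Local Notation co := (@simple_coroot _ _ Phi).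
Local Notation P i := (pit T (co i) (al i)).
Local Notation Pw := (pit_word T co al).
Local Notation I i p := (runinf (co i \o p)).
Local Notation D := (Pw ws).
Local Notation B := (@littelmann_module _ _ T Phi).
Local Notation dual := (sdual T ws).
Local Notation inv := (involution T ws).

Let T0' : 0 <= T := ltW T0.
Let TT : 0 <= T <= T. Proof. by rewrite T0' lexx. Qed.
Let fal i : co i (al i) = 2 := co_simple i.

Lemma runinf_end_shift i p q : P i q = P i p ->
  I i q T - I i p T = (co i (q T) - co i (p T)) / 2.
Proof.
move=> /(congr1 (fun r => co i (r T))); rewrite !pit_end // !scalarBZ fal; lra.
Qed.

Lemma littelmann_spec x i p q : is_path T p -> littelmann T x i p = Some q ->
  [/\ is_path T q, P i q = P i p & co i (q T) = co i (p T) + x].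
Proof.
rewrite /littelmann => pp; case: ifP => // xr [<-].
exact: xgetPex (littelmann_exists T0 (fal i) pp xr).
Qed.

Lemma littelmann_some x i p q : is_path T p -> is_path T q -> P i q = P i p ->
  co i (q T) = co i (p T) + x -> littelmann T x i p = Some q.
Proof.
move=> pp qp qE qT; have sh := runinf_end_shift qE.
have q0 := runinf_le0 (co i) qp TT.
have qI : I i q T <= co i (q T) by apply: (runinf_le (path_cont (co i) qp)).
have xr : - 2 * co i (p T) + 2 * I i p T <= x <= - 2 * I i p T by lra.
rewrite /littelmann ifT //; congr Some.
set A := (X in xget _ X); have [rp rE rT] : A (xget (fun=> 0) A).
  exact: xgetPex (littelmann_exists T0 (fal i) pp xr).
apply: (littelmann_unique T0 (fal i) rp qp); first by rewrite qE; exact: rE.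
by rewrite qT rT.
Qed.

Lemma module_invariant (Q : (R -> V) -> Prop) eta : is_path T eta -> Q eta ->
  (forall i p q, is_path T p -> is_path T q -> Q p -> P i q = P i p ->
     (co i (q T) - co i (p T)) / 2 \is a Num.int -> Q q) ->
  forall m, B eta m -> is_path T m /\ Q m.
Proof.
move=> ep Qe step m; elim=> // {m} i p q _ [pp Qp] /(littelmann_spec pp)[qp qE qT];
  split=> //; apply: step qE _ => //; rewrite qT addrAC subrr add0r.
  by rewrite divff ?pnatr_eq0 // rpred1.
by rewrite mulNr divff ?pnatr_eq0 // rpredN rpred1.
Qed.

Lemma module_path eta m : is_path T eta -> B eta m -> is_path T m.
Proof. by move=> ep /(module_invariant (Q := fun=> True) ep)[]. Qed.

Lemma module_raise eta b c i (n : nat) : is_path T b -> is_path T c -> B eta b ->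
  P i c = P i b -> co i (c T) = co i (b T) + 2 * n%:R -> B eta c.
Proof.
move=> + cp; elim: n b => [|n IH] b bp Bb cE cT.
  suff -> : c = b by [].
  by apply: (littelmann_unique T0 (fal i) cp bp cE); rewrite cT mulr0 addr0.
have sh := runinf_end_shift cE; have c0 := runinf_le0 (co i) cp TT.
have bI : I i b T <= co i (b T) by apply: (runinf_le (path_cont (co i) bp)).
have n0 : 0 <= n%:R :> R by [].
move: cT; rewrite -addn1 natrD => cT.
have [|d [dp dE dT]] := littelmann_exists T0 (fal i) (x := 2) bp; first by lra.
apply: (IH d) => //; last by rewrite dT cT; lra.
  exact: (littelmann_mod_e Bb (littelmann_some bp dp dE dT)).
by rewrite cE dE.
Qed.

Lemma module_lower eta b c i (n : nat) : is_path T b -> is_path T c -> B eta b ->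
  P i c = P i b -> co i (c T) = co i (b T) - 2 * n%:R -> B eta c.
Proof.
move=> + cp; elim: n b => [|n IH] b bp Bb cE cT.
  suff -> : c = b by [].
  by apply: (littelmann_unique T0 (fal i) cp bp cE); rewrite cT mulr0 subr0.
have sh := runinf_end_shift cE; have b0 := runinf_le0 (co i) bp TT.
have cI : I i c T <= co i (c T) by apply: (runinf_le (path_cont (co i) cp)).
have n0 : 0 <= n%:R :> R by [].
move: cT; rewrite -addn1 natrD => cT.
have [|d [dp dE dT]] := littelmann_exists T0 (fal i) (x := - 2) bp; first by lra.
apply: (IH d) => //; last by rewrite dT cT; lra.
  exact: (littelmann_mod_f Bb (littelmann_some bp dp dE dT)).
by rewrite cE dE.
Qed.

(** The admissible displacements form an interval, so all intermediate points of the string exist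
    and repeated e or f leads from [b] to [c]. *)
Lemma module_string eta b c i : is_path T b -> is_path T c -> B eta b ->
  P i c = P i b -> (co i (c T) - co i (b T)) / 2 \is a Num.int -> B eta c.
Proof.
move=> bp cp Bb cE /intrP[[n|n] nE].
  apply: (module_raise (n := n)) cE _ => //.
  by rewrite -pmulrn in nE; rewrite -nE; field.
apply: (module_lower (n := n.+1)) cE _ => //.
by rewrite NegzE mulrNz -pmulrn in nE; rewrite -[n.+1%:R]opprK -nE; field.
Qed.

Lemma weight_lattice_shift i p q : P i q = P i p ->
  (co i (q T) - co i (p T)) / 2 \is a Num.int ->
  weight_lattice Phi (p T) -> weight_lattice Phi (q T).
Proof.
move=> qE zi pP j; rewrite (pit_end_shift T0 (esym qE)) linearD linearZ /=.
apply: rpredD; first exact: pP.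
by apply: rpredM => //; apply: coroot_int; exact: simple_root.
Qed.

Lemma module_weight eta m : is_path T eta -> weight_lattice Phi (eta T) -> B eta m ->
  weight_lattice Phi (m T).
Proof.
move=> ep eP /(module_invariant (Q := fun p => weight_lattice Phi (p T)) ep)[] //.
by move=> i p q _ _ pP qE zi; exact: weight_lattice_shift qE zi pP.
Qed.

Lemma module_dominant eta m : is_path T eta -> B eta m -> D m = D eta.
Proof.
move=> ep /(module_invariant (Q := fun p => D p = D eta) ep)[] // i p q pp qp pE qE _.
by rewrite -pE -(dominant_right w0L w0E T0 i qp) qE (dominant_right w0L w0E T0 i pp).
Qed.

(** Descends from [inv p] to [dual p], undoing one transform at a time. Each step is extremal, so
    its amount is the value of a simple coroot on a Weyl image of the weight [p T], an integer. *)
Lemma dual_in_module p x u : is_path T p -> dominant T Phi p ->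
  weight_lattice Phi (p T) -> ws = x ++ u -> B (inv p) (Pw u (dual p)).
Proof.
move=> pp pd pP; elim/last_ind: x u => [|x i IH] u wE.
  by rewrite -[u]wE; exact: littelmann_gen.
rewrite cat_rcons in wE; have dp := dual_path ws T0 pp.
have up := word_path T0 u dp.
apply: (module_string (i := i)) (IH _ wE) _ _ => //=.
- exact: pit_path.
- by rewrite pit_idem.
have -> : (co i (Pw u (dual p) T) - co i (P i (Pw u (dual p)) T)) / 2 =
    I i (Pw u (dual p)) T by rewrite pit_end // scalarBZ fal; field.
rewrite (extremal w0L w0E T0 pp pd wE) (extremal_end w0L w0E T0 (x := rcons x i)) ?cat_rcons //.
by apply: weight_lattice_weyl; exact: weight_lattice_weyl.
Qed.

(** For [eta] itself the string is extremal. A move along [i] becomes after duality a move along the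
    opposite root [j]; with a reduced word ending in [j], obtained by braid invariance, it alters
    only the innermost coordinate, by an integer. *)
Lemma dual_string_int eta m : is_path T eta -> dominant T Phi eta ->
  weight_lattice Phi (eta T) -> B eta m -> string_int T co al ws (dual m).
Proof.
move=> ep ed eP /(module_invariant (Q := fun p => string_int T co al ws (dual p)) ep)[] //.
  suff H x u : ws = x ++ u -> string_int T co al u (dual eta) by exact: (H [::]).
  elim: u x => // i u IH x wE; split; first by apply: (IH (rcons x i)); rewrite cat_rcons.
  rewrite (extremal w0L w0E T0 ep ed wE) (extremal_end w0L w0E T0 (x := rcons x i)) ?cat_rcons //.
  by apply: weight_lattice_weyl; exact: weight_lattice_weyl.
move=> i p q pp qp ps qE zi; have [j ij] := longest_star w0L w0E i.
have [v [rv vE]] := longest_rcons w0L w0E j.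
have rws := longest_reduced w0E.
have dpp := dual_path ws T0 pp; have dqp := dual_path ws T0 qp.
have [_ Hp] := word_eq T0 rv rws vE dpp; have [_ Hq] := word_eq T0 rv rws vE dqp.
move: ps; rewrite -Hp -Hq !string_int_rcons => -[hI hs].
have E : P j (dual q) = P j (dual p).
  by rewrite -(dual_pit T0 qp ij) qE; exact: dual_pit.
split; last by rewrite E.
have := runinf_end_shift E; rewrite !dual_end //.
have cE x : co j (W ws x) = - co i x.
  by rewrite -(coroot_star x ij) scalarN opprK.
rewrite !cE => sh.
have -> : I j (dual q) T = I j (dual p) T - (co i (q T) - co i (p T)) / 2 by lra.
by rewrite rpredB.
Qed.

Lemma word_weight u p : string_int T co al u p -> weight_lattice Phi (p T) ->
  weight_lattice Phi (Pw u p T).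
Proof.
move=> + pP; elim: u => //= i u IH [si zi] j; rewrite pit_end // scalarBZ.
apply: rpredB; first exact: IH.
by apply: rpredM => //; apply: coroot_int; exact: simple_root.
Qed.

Lemma dual_concat p q : is_path T p -> is_path T q ->
  dual (concat T p q) = concat T (dual q) (dual p).
Proof.
move=> pp qp; rewrite /sdual kappa_concat //; apply/funext => t /=.
rewrite /concat /on0T; case: ifP => _; last by rewrite linear0 oppr0.
by case: ifP => // _; rewrite linearD opprD.
Qed.

(** Invariant along suffixes [u] of [ws]: the first factor is [Pw u (dual m)] and the second stays
    in the module of [inv p]. Each letter raises the second factor by an integer, because the string
    of [dual m] is integral and the infimum of the second factor is the value at its end. *)
Lemma involution_concat p m eta : is_path T p -> dominant T Phi p ->
  weight_lattice Phi (p T) -> is_path T eta -> dominant T Phi eta ->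
  weight_lattice Phi (eta T) -> B eta m -> dominant T Phi (concat T p m) ->
  LR T Phi (inv eta) (inv p) (inv (concat T p m)).
Proof.
move=> pp pd pP ep ed eP Bm gd; have mp := module_path ep Bm.
have gp := concat_path T0 pp mp.
have dp := dual_path ws T0 pp; have dm := dual_path ws T0 mp.
have ip := involution_path ws T0 pp.
have sm := dual_string_int ep ed eP Bm.
have mP : weight_lattice Phi (dual m T).
  rewrite dual_end //; apply: weight_lattice_weyl; exact: module_weight Bm.
have iP : weight_lattice Phi (inv p T) by rewrite (involution_end w0L w0E T0 pp pd).
have H x u : ws = x ++ u -> exists2 b, is_path T b /\ B (inv p) b &
    Pw u (dual (concat T p m)) = concat T (Pw u (dual m)) b.
  elim: u x => [|i u IH] x wE.
    exists (dual p); last by rewrite /= dual_concat.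
    by split=> //; apply: (dual_in_module (x := ws) (u := [::])) => //; rewrite cats0.
  have wE' : ws = rcons x i ++ u by rewrite cat_rcons.
  have [b [bp Bb] bE] := IH _ wE'.
  have ext := extremal w0L w0E T0 gp gd wE.
  set a := Pw u (dual m) in bE; have ap : is_path T a by exact: word_path.
  have [su ai] : string_int T co al u (dual m) /\ I i a T \is a Num.int.
    by move: sm; rewrite {1}wE string_int_cat => -[[su ai] _].
  have aP : weight_lattice Phi (a T) by exact: word_weight.
  have bP : weight_lattice Phi (b T) by exact: module_weight Bb.
  have b0 := path0 bp.
  have half : 2 * (T - T / 2) = T by field.
  have t1 : T / 2 <= T <= T by move: T0; lra.
  (* The concatenated path is dominant, so its dual is extremal: the infimum of the whole path is at
     its end, hence so is that of the second factor. *)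
  have bI : I i b T = co i (b T).
    apply/eqP; rewrite eq_le; apply/andP; split.
      by apply: (runinf_le (path_cont (co i) bp)).
    apply: (le_runinf (path_cont (co i) bp)) => // r rT /=.
    have cp := concat_path T0 ap bp.
    (* The time at which the concatenation runs through [b r]. *)
    have t2 : T / 2 <= (r + T) / 2 <= T by lra.
    have t3 : 0 <= (r + T) / 2 <= T by move: T0; lra.
    have : I i (concat T a b) T <= co i (concat T a b ((r + T) / 2)).
      by apply: (runinf_le (path_cont (co i) cp)).
    rewrite -bE ext bE !concatEr // half !linearD /=.
    by rewrite (_ : 2 * _ = r); [lra | field].
  have c0 : 0 <= co i (a T) - I i a T.
    by rewrite subr_ge0; apply: (runinf_le (path_cont (co i) ap)).
  exists (raise T (co i) (al i) (co i (a T) - I i a T) b); last first.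
    by rewrite /= bE pit_concat.
  split; first exact: raise_path.
  have rp := raise_path (co i) (al i) T0 c0 bp.
  apply: (module_string bp rp Bb (pit_raise T0 (fal i) c0 bp)).
  rewrite raiseE // scalarBZ fal bI; set c := co i (a T) - _ in c0 *.
  have -> : (co i (b T) - Num.min 0 (c + co i (b T)) * 2 - co i (b T)) / 2 =
     - Num.min 0 (c + co i (b T)) by field.
  rewrite rpredN; have cb : c + co i (b T) \is a Num.int.
    by rewrite rpredD ?rpredB.
  by case: leP => // _; rewrite rpred0.
have [b [bp Bb] bE] := H [::] ws erefl; split; last first.
  exact: (involution_dominant w0L w0E T0 gp).
exists b => //; rewrite /involution bE; congr concat.
(* The first factor is [inv m], which equals [inv eta] because [m] and [eta] have the same dominant
   path. *)
by apply: (involution_eq w0L w0E T0 ep mp); rewrite (module_dominant ep Bm).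
Qed.

End LittelmannModules.

(** * The involution on Littlewood-Richardson sets of paths *)

Theorem proposition4p9 (R : realType) (V : vectType R) (Phi : rootSystem V)
    (w0 : V -> V) (ws : seq 'I_(rank Phi)) (T : R) (pi eta : R -> V) :
  longest_element Phi w0 -> reduced_decomposition w0 ws -> 0 < T ->
  is_path T pi -> integral T Phi pi -> dominant T Phi pi ->
  is_path T eta -> integral T Phi eta -> dominant T Phi eta ->
  let I := schutzenberger T w0 ws in
  [/\ set_bij (LR T Phi pi eta) (LR T Phi (I eta) (I pi)) I,
      forall g, LR T Phi pi eta g -> I (I g) = g &
      forall g, LR T Phi pi eta g -> I g T = g T].
Proof.
move=> w0L w0E T0 pip [piP _] pid ep [eP _] ed I.
have IE g : I g = involution T ws g.
  by rewrite /I /schutzenberger; have [-> _] := w0E.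
have Ip p : is_path T p -> is_path T (I p) by move=> pp; rewrite IE; exact: involution_path.
have Id p : is_path T p -> dominant T Phi (I p).
  by move=> pp; rewrite IE; exact: (involution_dominant w0L w0E T0).
have IK p : is_path T p -> dominant T Phi p -> I (I p) = p.
  by move=> pp pd; rewrite !IE; exact: (involutionK w0L w0E T0).
have IT p : is_path T p -> dominant T Phi p -> I p T = p T.
  by move=> pp pd; rewrite IE; exact: (involution_end w0L w0E T0).
have LRp p q g : is_path T p -> is_path T q -> LR T Phi p q g ->
    is_path T g /\ dominant T Phi g.
  move=> pp qp [[m Bm <-] gd]; split=> //.
  by apply: concat_path => //; exact: module_path Bm.
have fwd p q : is_path T p -> dominant T Phi p -> weight_lattice Phi (p T) ->
    is_path T q -> dominant T Phi q -> weight_lattice Phi (q T) ->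
    forall g, LR T Phi p q g -> LR T Phi (I q) (I p) (I g).
  move=> pp pd pP qp qd qP _ [[m Bm <-] gd]; rewrite !IE.
  exact: (involution_concat w0L w0E T0).
split.
- split.
  + by move=> g; exact: fwd.
  + move=> g h /set_mem gL /set_mem hL E.
    have [[gp gd] [hp hd]] := (LRp _ _ _ pip ep gL, LRp _ _ _ pip ep hL).
    by rewrite -(IK g) // E IK.
  + move=> g gL; have [gp gd] := LRp _ _ _ (Ip _ ep) (Ip _ pip) gL.
    (* Applied to the pair [I eta], [I pi], the forward map lands in the original set, since [I] is
       an involution on dominant paths. *)
    exists (I g); last exact: IK.
    have := fwd _ _ (Ip _ ep) (Id _ ep) _ (Ip _ pip) (Id _ pip) _ g gL.
    by rewrite !IK // !IT //; apply.
- by move=> g /(LRp _ _ _ pip ep)[]; exact: IK.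
- by move=> g /(LRp _ _ _ pip ep)[]; exact: IT.
Qed.
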